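(* Let $\mathcal{P}$ be a set of $n$ points in $\mathbb{R}^2$ in the existential uncertainty model with $p_v\in(0,1)$ for all $v$, let $\tau\in(0,1/2]$ and $\delta\in(0,1)$, and suppose there is a point $v^\star\in\mathbb{R}^2$ that lies in the convex hull of a random realization of $\mathcal{P}$ with probability at least $1-\delta/2$. Run the construction below with parameters $\tau_1=c_1\tau/\lambda$ and $N=c_2\tau_1^{-2}\log(1/\delta)=O\!\left(\frac{\lambda^2}{\tau^2}\log\frac{1}{\delta}\right)$ for suitable absolute constants $c_1,c_2>0$. Then with probability at least $1-\delta$ (over the sampling), for every $t\ge 0$ and every direction $u$, $$\Pr_{P\sim\mathcal{P}}[\omega(P,u)\le t]-\tau\le\Pr_{S\sim\mathcal{S}}[\omega(S,u)\le t]\le\Pr_{P\sim\mathcal{P}}[\omega(P,u)\le t]+\tau.$$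
   Context: Existential model: each $v\in\mathcal{P}$ is present in a random realization independently with probability $p_v$. For a finite point set $P$, $f(P,u)=\max_{p\in P}\langle u,p\rangle$ (with $f(\emptyset,u)=0$) and $\omega(P,u)=f(P,u)+f(P,-u)$. Construction: let $\lambda_v=-\ln(1-p_v)$ and $\lambda=\sum_{v\in\mathcal{P}}\lambda_v$; let $\mathfrak{A}$ be the probability measure on $\mathcal{P}$ with $\mathfrak{A}(\{v\})=\lambda_v/\lambda$. Take $N$ independent samples from $\mathfrak{A}$ (repetitions allowed, co-located copies kept as separate points). The stochastic set $\mathcal{S}$ consists of these $N$ sample points, each present independently with existence probability $1-\exp(-\lambda/N)$.
   Formalization: In N, log(1/δ) is replaced by ln(max(2,1/δ)) and N is rounded up to an integer: for δ ≤ 1/2 this is the stated formula; for δ near 1 the literal N shrinks to a single sample point of width 0 and the claim fails. *)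

(* Defs.v *)
From mathcomp Require Import all_boot all_order all_algebra.
From mathcomp Require Import boolp reals sequences exp.

Set Implicit Arguments.
Unset Strict Implicit.
Unset Printing Implicit Defensive.

Import Order.TTheory GRing.Theory Num.Theory.
Local Open Scope ring_scope.

Section Geometry.
Variable R : realType.
Implicit Types (u v : 'rV[R]_2) (P : seq 'rV[R]_2).

Definition dotp u v : R := \sum_i u 0 i * v 0 i.

Definition supp P u : R :=
  if P is q :: P' then \big[Num.max/dotp u q]_(w <- P') dotp u w else 0.

Definition width P u : R := supp P u + supp P (- u).

Definition in_hull P v : Prop :=
  exists a : 'I_(size P) -> R,
    [/\ forall i, 0 <= a i, \sum_i a i = 1 & v = \sum_i a i *: P`_i].

End Geometry.

Section FiniteProbability.
Variable R : realType.

(* Every random object here takes finitely many values, so an event is measured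
   by summing the mass function [mu] over it. *)
Definition prob (T : finType) (mu : T -> R) (E : T -> Prop) : R :=
  \sum_(a | `[< E a >]) mu a.

Definition realization_pmf (I : finType) (p : I -> R) (B : {set I}) : R :=
  (\prod_(i in B) p i) * \prod_(i in ~: B) (1 - p i).

Definition iid_pmf (I : finType) (mu : I -> R) (N : nat)
    (s : {ffun 'I_N -> I}) : R :=
  \prod_j mu (s j).

End FiniteProbability.

Section Model.
Variable R : realType.

(* A stochastic point set is a finite family [x] of locations with existence
   probabilities [p]. Indices, not locations, are present or absent, so
   co-located copies stay separate points. *)
Definition realized (I : finType) (x : I -> 'rV[R]_2) (B : {set I}) :
    seq 'rV[R]_2 :=
  [seq x i | i in B].

Definition hull_prob (I : finType) (x : I -> 'rV[R]_2) (p : I -> R)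
    (v : 'rV[R]_2) : R :=
  prob (realization_pmf p) (fun B => in_hull (realized x B) v).

Definition width_cdf (I : finType) (x : I -> 'rV[R]_2) (p : I -> R)
    (u : 'rV[R]_2) (t : R) : R :=
  prob (realization_pmf p) (fun B => width (realized x B) u <= t).

Definition rate (I : finType) (p : I -> R) (i : I) : R := - ln (1 - p i).

Definition total_rate (I : finType) (p : I -> R) : R := \sum_i rate p i.

Definition sampling_pmf (I : finType) (p : I -> R) (i : I) : R :=
  rate p i / total_rate p.

Definition sample_exist_prob (I : finType) (p : I -> R) (N : nat) : R :=
  1 - expR (- (total_rate p / N%:R)).

(* log (1 / delta), clipped below at ln 2. It is ln (1 / delta) for
   delta <= 1/2. Without the clipping, as delta tends to 1 the sample size
   would drop to a single point, which always has width 0. *)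
Definition log_conf (delta : R) : R := ln (Num.max 2 delta^-1).

Definition tau1 (c1 tau lambda : R) : R := c1 * tau / lambda.

(* The argument of the ceiling is nonnegative whenever c2 is, so the absolute
   value is only a cast from int to nat. *)
Definition sample_size (c1 c2 tau delta lambda : R) : nat :=
  `|Num.ceil (c2 * (tau1 c1 tau lambda) ^- 2 * log_conf delta)|%N.

End Model.

(* Main.v *)
Require Import Defs.
From mathcomp Require Import all_boot all_order all_algebra.
From mathcomp Require Import boolp reals sequences exp.
From mathcomp Require Import ring lra zify.

Import Order.TTheory GRing.Theory Num.Theory.
Local Open Scope ring_scope.

(** Replacing each existence probability by its rate turns the probability that
    a region contains no present point into [exp (- rate of the region)].
    Conditioning on the minimal value in direction [u], the width distribution
    becomes a Stieltjes sum of such void probabilities of half-planes, and Abel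
    summation shows that it moves by at most [3 e] when the rates of all
    half-planes move by at most [e].

    It remains to bound the deviation of the empirical measure uniformly over
    half-planes without any logarithmic factor.  A half-plane is a vector of
    [R^3]; by moving inside its cell of the arrangement dual to a random sample,
    one writes it as a positive combination of four vertices of the
    arrangement.  Points on which these vertices do not take both signs
    strictly are classified by the vertices alone, and an epsilon-net argument
    bounds the mass of the others, giving brackets of width [16 ^- j] in number
    exponential in [j].  Chaining along these brackets with Chernoff bounds at
    tolerances proportional to [2 ^- j] gives the uniform bound. *)

Set Implicit Arguments.
Unset Strict Implicit.
Unset Printing Implicit Defensive.

(** * Cells and vertices of an arrangement of planes through the origin of [R^3] *)

Section Cutting.
Variable R : realType.
Notation vec := (R * R * R)%type.
Implicit Types (a d h y z : vec) (r s : R).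

Definition dot3 (a b : vec) : R := a.1.1 * b.1.1 + a.1.2 * b.1.2 + a.2 * b.2.

Definition cross3 (a b : vec) : vec :=
  (a.1.2 * b.2 - a.2 * b.1.2, a.2 * b.1.1 - a.1.1 * b.2,
   a.1.1 * b.1.2 - a.1.2 * b.1.1).

Definition move3 h s d : vec :=
  (h.1.1 + s * d.1.1, h.1.2 + s * d.1.2, h.2 + s * d.2).

(** The pairing of [h] with [sign3 h] is the l1 norm of [h]. A motion orthogonal to [sign3 h]
    preserves this pairing, so it never reaches 0. *)
Definition sign3 h : vec := (Num.sg h.1.1, Num.sg h.1.2, Num.sg h.2).

Lemma vec_eq0 h : h.1.1 = 0 -> h.1.2 = 0 -> h.2 = 0 -> h = 0.
Proof. by case: h => [[h1 h2] h3] /= -> -> ->. Qed.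

Lemma dot3_move h s d y : dot3 (move3 h s d) y = dot3 h y + s * dot3 d y.
Proof. by rewrite /dot3 /=; ring. Qed.

Lemma triple_product z a y : dot3 (cross3 z a) y = dot3 a (cross3 y z).
Proof. by rewrite /dot3 /=; ring. Qed.

Lemma dot3_crossr a b : dot3 (cross3 a b) b = 0.
Proof. by rewrite /dot3 /=; ring. Qed.

Lemma dot3_self_gt0 h : h != 0 -> 0 < dot3 h h.
Proof.
move=> h0; have ge0 : 0 <= dot3 h h by rewrite /dot3; nra.
rewrite lt_neqAle ge0 andbT eq_sym; apply: contra_neq h0 => hh.
by apply: vec_eq0; move: hh; rewrite /dot3; nra.
Qed.

Lemma dot3_sign_gt0 h : h != 0 -> 0 < dot3 h (sign3 h).
Proof.
move=> h0; rewrite /dot3 /= ![_ * Num.sg _]mulrC -!normrEsg.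
have [[n1 n2] n3] := (normr_ge0 h.1.1, normr_ge0 h.1.2, normr_ge0 h.2).
rewrite lt_neqAle !addr_ge0 // andbT eq_sym; apply: contra_neq h0 => hh.
by apply: vec_eq0; apply/eqP; rewrite -normr_eq0; apply/eqP; lra.
Qed.

(* [h], orthogonal to [a] and [b], is proportional to [a x b]. *)
Lemma orthogonal_cross h a b y : dot3 h a = 0 -> dot3 h b = 0 ->
  dot3 (cross3 a b) (cross3 a b) * dot3 h y
  = dot3 h (cross3 a b) * dot3 (cross3 a b) y.
Proof.
case: h a b y => [[h1 h2] h3] [[a1 a2] a3] [[b1 b2] b3] [[y1 y2] y3].
rewrite /dot3 /= => ha hb.
set c1 := a2 * b3 - a3 * b2; set c2 := a3 * b1 - a1 * b3.
set c3 := a1 * b2 - a2 * b1.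
have x1 : h2 * c3 - h3 * c2 = 0.
  have -> : h2 * c3 - h3 * c2
     = a1 * (h1 * b1 + h2 * b2 + h3 * b3) - b1 * (h1 * a1 + h2 * a2 + h3 * a3).
    by rewrite /c2 /c3; ring.
  by rewrite ha hb; ring.
have x2 : h3 * c1 - h1 * c3 = 0.
  have -> : h3 * c1 - h1 * c3
     = a2 * (h1 * b1 + h2 * b2 + h3 * b3) - b2 * (h1 * a1 + h2 * a2 + h3 * a3).
    by rewrite /c1 /c3; ring.
  by rewrite ha hb; ring.
have x3 : h1 * c2 - h2 * c1 = 0.
  have -> : h1 * c2 - h2 * c1
     = a3 * (h1 * b1 + h2 * b2 + h3 * b3) - b3 * (h1 * a1 + h2 * a2 + h3 * a3).
    by rewrite /c1 /c2; ring.
  by rewrite ha hb; ring.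
apply/eqP; rewrite -subr_eq0; apply/eqP.
(* Lagrange's identity; the first factors are the coordinates of [h x (a x b)], all zero by [x1],
   [x2], [x3]. *)
transitivity ((h2 * c3 - h3 * c2) * (c3 * y2 - c2 * y3)
  + (h3 * c1 - h1 * c3) * (c1 * y3 - c3 * y1)
  + (h1 * c2 - h2 * c1) * (c2 * y1 - c1 * y2)).
  by clearbody c1 c2 c3; ring.
by rewrite x1 x2 x3; ring.
Qed.

Variables (K : finType) (v : K -> vec) (k1 k2 k3 : K).
Hypotheses (vk1 : v k1 = (1, 0, 0)) (vk2 : v k2 = (0, 1, 0)).
Hypothesis (vk3 : v k3 = (0, 0, 1)).

(** [h1] lies in the closure of the face of the arrangement that contains [h]. *)
Definition in_cell h h1 := forall k,
  [/\ 0 < dot3 h (v k) -> 0 <= dot3 h1 (v k),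
      dot3 h (v k) < 0 -> dot3 h1 (v k) <= 0
    & dot3 h (v k) = 0 -> dot3 h1 (v k) = 0].

Lemma in_cell_trans h h1 h2 : in_cell h h1 -> in_cell h1 h2 -> in_cell h h2.
Proof.
move=> c1 c2 k; have [p1 n1 z1] := c1 k; have [p2 n2 z2] := c2 k.
split=> [/p1|/n1|/z1/z2 //]; rewrite le_eqVlt => /orP[/eqP|].
- by move=> /esym/z2->.
- by move/p2.
- by move=> /z2->.
- by move/n2.
Qed.

(** Follow the ray from [h] along [d] up to the first new plane. The constant pairing with [sign3 h]
    keeps the endpoint nonzero. *)
Lemma move_to_facet h d : h != 0 -> d != 0 -> dot3 d (sign3 h) = 0 ->
  (forall k, dot3 h (v k) = 0 -> dot3 d (v k) = 0) ->
  exists s, [/\ 0 < s, in_cell h (move3 h s d), move3 h s d != 0 &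
    exists k, dot3 (move3 h s d) (v k) = 0 /\ dot3 d (v k) != 0].
Proof.
move=> h0 d0 dh zd.
(* Otherwise, on the three axes, the terms [sg h_i * d_i] are nonnegative with sum 0, which forces
   [d = 0]. *)
have [k0 k0P] : exists k, dot3 h (v k) * dot3 d (v k) < 0.
  apply: contrapT => /forallNP neg.
  have coord r r' : (r = 0 -> r' = 0) -> ~ (r * r' < 0) ->
      0 <= Num.sg r * r' /\ (Num.sg r * r' = 0 -> r' = 0).
    move=> r0; case: (sgrP r) => [/r0 ->|rp|rn]; first by rewrite !mulr0.
      by rewrite mul1r; move/negP; rewrite -leNgt pmulr_rge0.
    rewrite mulN1r; move/negP; rewrite -leNgt nmulr_rge0 //.
    by rewrite oppr_ge0 => ?; split=> // /eqP; rewrite oppr_eq0 => /eqP.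
  have := coord _ _ (zd k1) (neg k1); have := coord _ _ (zd k2) (neg k2).
  have := coord _ _ (zd k3) (neg k3); rewrite vk1 vk2 vk3.
  move: dh; rewrite /dot3 /= !mulr0 !mulr1 !addr0 !add0r.
  rewrite ![d.1.1 * _]mulrC ![d.1.2 * _]mulrC ![d.2 * _]mulrC.
  move=> sum0 [p3 q3] [p2 q2] [p1 q1].
  move/negP: d0; apply; apply/eqP.
  by apply: vec_eq0; [apply: q1|apply: q2|apply: q3]; lra.
(* [F k] is the time at which the ray meets the plane of [v k], and [P] selects the planes that it
   approaches. *)
pose F k := - (dot3 h (v k) / dot3 d (v k)).
pose P k := dot3 h (v k) * dot3 d (v k) < 0.
have [k kP kmin] := @Order.TotalTheory.arg_minP _ _ _ k0 P F k0P.
exists (F k).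
have dk0 : dot3 d (v k) != 0.
  by apply: contraTneq kP => e; rewrite /P e mulr0 ltxx.
have hk : dot3 (move3 h (F k) d) (v k) = 0.
  by rewrite dot3_move /F mulNr divfK // subrr.
have Fgt0 j : P j -> 0 < F j.
  move=> Pj; have dj0 : dot3 d (v j) != 0.
    by apply: contraTneq Pj => e; rewrite /P e mulr0 ltxx.
  rewrite /F oppr_gt0 -(pmulr_llt0 _ (_ : 0 < dot3 d (v j) ^+ 2)).
    by rewrite expr2 mulrA divfK.
  by rewrite lt_neqAle eq_sym sqrf_eq0 dj0 sqr_ge0.
split; first exact: Fgt0.
- move=> j; rewrite dot3_move.
  have s0 := Fgt0 _ kP.
  have le_s : P j -> F k <= F j by move=> ?; apply: kmin.
  split=> [hj|hj|hj].
  + have [dj|dj] := leP 0 (dot3 d (v j)); first by rewrite addr_ge0 ?mulr_ge0 // ltW.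
    have /le_s : P j by rewrite /P pmulr_rlt0.
    by rewrite [X in _ <= X]/F -mulrN -invrN ler_pdivlMr ?oppr_gt0 // mulrN; lra.
  + have [dj|dj] := leP (dot3 d (v j)) 0.
      by rewrite -oppr_ge0 opprD addr_ge0 ?oppr_ge0 ?pmulr_rle0 // ltW.
    have /le_s : P j by rewrite /P nmulr_rlt0.
    by rewrite [X in _ <= X]/F -mulNr ler_pdivlMr //; lra.
  + by rewrite hj zd // mulr0 addr0.
- have := dot3_sign_gt0 h0; apply: contraTneq => e.
  have : dot3 (move3 h (F k) d) (sign3 h) = 0 by rewrite e /dot3 /= !mul0r !addr0.
  by rewrite dot3_move dh mulr0 addr0 => ->; rewrite ltxx.
- by exists k.
Qed.

(** An open cone rather than a segment: only signs of pairings matter, so the weights need not sum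
    to 1. *)
Definition in_segment h h1 h2 := exists r s, [/\ 0 < r, 0 < s &
  forall y, dot3 h y = r * dot3 h1 y + s * dot3 h2 y].

(** Move from [h] both ways along a direction orthogonal to [z] and to [sign3 h]; [h] lies between
    the two points reached. Normals parallel to [z] pair to 0 with this direction, so each plane
    newly hit has a normal not parallel to [z]. *)
Lemma split_cell h z : h != 0 -> z != 0 -> dot3 h z = 0 ->
  (forall k, dot3 h (v k) = 0 -> cross3 (v k) z = 0) ->
  exists g : bool -> vec, in_segment h (g true) (g false) /\
    forall b, [/\ g b != 0, in_cell h (g b) &
      exists k, dot3 (g b) (v k) = 0 /\ cross3 (v k) z != 0].
Proof.
move=> h0 z0 hz zz; pose d := cross3 z (sign3 h).
have dE y : cross3 y z = 0 -> dot3 d y = 0.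
  by rewrite /d triple_product => ->; rewrite /dot3 /= !mulr0 !addr0.
have d0 : d != 0.
  apply: contra_neq z0 => d0; have hs := dot3_sign_gt0 h0.
  (* The double cross product formula for [h x (z x sign3 h)]. *)
  have zE y : dot3 h (sign3 h) * dot3 z y - dot3 h z * dot3 (sign3 h) y
      = dot3 (cross3 h d) y.
    by rewrite /d /dot3 /=; ring.
  have zy y : dot3 z y = 0.
    apply: (mulfI (lt0r_neq0 hs)); move: (zE y); rewrite hz d0 mul0r subr0 => ->.
    by rewrite /dot3 /=; ring.
  apply/eqP/negPn/negP => /dot3_self_gt0.
  by rewrite zy ltxx.
pose Nd : vec := move3 0 (-1) d.
have dNd y : dot3 Nd y = - dot3 d y.
  by rewrite dot3_move mulN1r /dot3 /= !mul0r !add0r.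
have Nd0 : Nd != 0.
  apply: contra_neq d0 => e; apply/eqP/negPn/negP => /dot3_self_gt0.
  by rewrite -oppr_lt0 -dNd e /dot3 /= !mul0r !addr0 ltxx.
clearbody Nd; have dh : dot3 d (sign3 h) = 0 by exact: dot3_crossr.
have [|s [s0 cs ms [k [hk dk]]]] := move_to_facet h0 d0 dh.
  by move=> k /zz/dE.
have [||s' [s0' cs' ms' [k' [hk' dk']]]] := move_to_facet h0 Nd0.
- by rewrite dNd dh oppr0.
- by move=> j /zz/dE; rewrite dNd => ->; rewrite oppr0.
exists (fun b => if b then move3 h s d else move3 h s' Nd); split.
  (* Barycentric weights of [h] between [h + s d] and [h - s' d]. *)
  exists (s' / (s + s')), (s / (s + s')).
  have ss : 0 < s + s' by rewrite addr_gt0.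
  split; rewrite ?divr_gt0 // => y; rewrite !dot3_move dNd.
  by field; rewrite gt_eqF.
case; split=> //.
  by exists k; split=> //; apply: contra_neq dk => /dE.
by exists k'; split=> //; apply: contra_neq dk'; move/dE; rewrite dNd => ->; rewrite oppr0.
Qed.

(** A ray cut out by two planes, named by their indices and a choice of orientation, so that
    vertices can be counted. *)
Definition vertex (w : K * K * bool) : vec :=
  move3 0 ((-1) ^+ w.2) (cross3 (v w.1.1) (v w.1.2)).

Definition same_ray h h1 := exists r, 0 < r /\ forall y, dot3 h y = r * dot3 h1 y.

Lemma vertex_of_zeros h j k : h != 0 -> dot3 h (v j) = 0 -> dot3 h (v k) = 0 ->
  cross3 (v j) (v k) != 0 -> exists w, same_ray h (vertex w).
Proof.
move=> h0 hj hk c0; have cc := dot3_self_gt0 c0.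
have E y := orthogonal_cross y hj hk.
have hc0 : dot3 h (cross3 (v j) (v k)) != 0.
  apply/eqP => e; have := dot3_self_gt0 h0.
  by rewrite -(pmulr_rgt0 _ cc) E e mul0r ltxx.
pose c := dot3 h (cross3 (v j) (v k)).
exists (j, k, c < 0), (`|c| / dot3 (cross3 (v j) (v k)) (cross3 (v j) (v k))).
split; first by rewrite divr_gt0 // normr_gt0.
move=> y; rewrite /vertex dot3_move /=.
have -> : dot3 0 y = 0 by rewrite /dot3 /= !mul0r !addr0.
apply: (mulfI (lt0r_neq0 cc)); rewrite E -/c [in LHS](numEsg c) sgr_def hc0 mulr1n.
by field; rewrite gt_eqF.
Qed.

Lemma same_ray_in_cell h h1 : same_ray h h1 -> in_cell h h1.
Proof.
move=> [r [r0 E]] k; split; rewrite E.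
- by rewrite pmulr_rgt0 // => /ltW.
- by rewrite pmulr_rlt0 // => /ltW.
- by move/eqP; rewrite mulf_eq0 gt_eqF //= => /eqP.
Qed.

(** If a second independent plane contains [h], then [h] is already a vertex, used twice with half
    weights. Otherwise splitting inside the plane of [v k0] ends at two vertices. *)
Lemma edge_cutting h k0 : h != 0 -> dot3 h (v k0) = 0 -> v k0 != 0 ->
  exists w : bool -> K * K * bool,
    in_segment h (vertex (w true)) (vertex (w false)) /\
    forall b, in_cell h (vertex (w b)).
Proof.
move=> h0 hk0 vk0.
have [[k [hk ck]]|] := pselect (exists k, dot3 h (v k) = 0 /\ cross3 (v k) (v k0) != 0).
  have [w hw] := vertex_of_zeros h0 hk hk0 ck.
  exists (fun=> w); split; last by move=> _; apply: same_ray_in_cell.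
  have [r [r0 E]] := hw; exists (r / 2), (r / 2).
  by split; rewrite ?divr_gt0 // => y; rewrite E; field.
move=> /forallNP no; have [] := split_cell h0 vk0 hk0.
  by move=> k hk; apply/eqP/negPn/negP => c0; apply: (no k).
move=> g [[r [s [r0 s0 E]]] gP].
have /choice[w wP] : forall b, exists w, same_ray (g b) (vertex w).
  move=> b; have [gb cb [k [gk ck]]] := gP b.
  by apply: (vertex_of_zeros gb gk _ ck); have [_ _ ->] := cb k0.
exists w; split.
  have [rt [rt0 Et]] := wP true; have [rf [rf0 Ef]] := wP false.
  exists (r * rt), (s * rf); split; rewrite ?mulr_gt0 // => y.
  by rewrite E Et Ef !mulrA.
move=> b; have [_ cb _] := gP b; apply: (in_cell_trans cb).
exact/same_ray_in_cell.
Qed.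

(** Splitting [h] between two points on planes, then each of these between two vertices, makes [h] a
    positive combination of four vertices of its cell. Positivity of the weights gives both sign
    implications. *)
Lemma cell_cutting h : h != 0 ->
  exists w : bool * bool -> K * K * bool,
    [/\ forall i, in_cell h (vertex (w i)),
        forall y, (forall i, dot3 (vertex (w i)) y <= 0) -> dot3 h y <= 0
      & forall y i, (forall j, 0 <= dot3 (vertex (w j)) y) ->
          0 < dot3 (vertex (w i)) y -> 0 < dot3 h y].
Proof.
move=> h0.
suff [w [wc [g [[r [s [r0 s0 E]]] gP]]]] :
    exists w : bool * bool -> K * K * bool,
      (forall i, in_cell h (vertex (w i))) /\
      exists g, in_segment h (g true) (g false) /\
        forall b, in_segment (g b) (vertex (w (b, true))) (vertex (w (b, false))).
  exists w; split=> // y.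
    move=> wn; have gn b : dot3 (g b) y <= 0.
      have [rb [sb [rb0 sb0 ->]]] := gP b.
      by rewrite -oppr_ge0 opprD addr_ge0 // oppr_ge0 pmulr_rle0.
    by rewrite E -oppr_ge0 opprD addr_ge0 // oppr_ge0 pmulr_rle0.
  case=> b b' wn wp; have gn c : 0 <= dot3 (g c) y.
    have [rb [sb [rb0 sb0 ->]]] := gP c.
    by rewrite addr_ge0 // pmulr_rge0.
  have gp : 0 < dot3 (g b) y.
    have [rb [sb [rb0 sb0 ->]]] := gP b.
    case: b' wp => wp; [rewrite ltr_pwDl|rewrite ltr_wpDl];
      by rewrite ?mulr_gt0 // mulr_ge0 // ltW.
  rewrite E; case: b {wp} gp => gp; [rewrite ltr_pwDl|rewrite ltr_wpDl];
    by rewrite ?mulr_gt0 // mulr_ge0 // ltW.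
have [[k [hk vk]]|] := pselect (exists k, dot3 h (v k) = 0 /\ v k != 0).
  have [w [ws wc]] := edge_cutting h0 hk vk.
  exists (fun i => w i.2); split=> [i|]; first exact: wc.
  exists (fun=> h); split=> //; exists (1 / 2), (1 / 2).
  by split=> [||y]; rewrite ?divr_gt0 //; field.
move=> /forallNP no.
(* Here only zero vectors [v k] vanish at [h], so any [z] orthogonal to [h] can guide the first
   splitting. *)
have [z z0 hz] : exists2 z, z != 0 & dot3 h z = 0.
  have [h11|h11] := eqVneq h.1.1 0; last first.
    exists (h.1.2, - h.1.1, 0); last by rewrite /dot3 /=; ring.
    by apply: contra_neq h11 => -[_ /eqP]; rewrite oppr_eq0 => /eqP.
  exists (1, 0, 0); last by rewrite /dot3 /= h11; ring.
  by apply/eqP => -[/eqP]; rewrite oner_eq0.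
have [k hk|g [gs gP]] := split_cell h0 z0 hz.
  have -> : v k = 0 by apply/eqP/negPn/negP => vk; apply: (no k).
  by rewrite /cross3 /= !mul0r !subr0.
have /choice[w wP] : forall b, exists w : bool -> K * K * bool,
    in_segment (g b) (vertex (w true)) (vertex (w false)) /\
    forall c, in_cell (g b) (vertex (w c)).
  move=> b; have [gb cb [k [gk ck]]] := gP b.
  apply: (edge_cutting gb gk); apply: contra_neq ck => ->.
  by rewrite /cross3 /= !mul0r !subr0.
exists (fun i => w i.1 i.2); split=> [[b c]|] /=.
  by have [_ cb _] := gP b; apply: (in_cell_trans cb); have [_] := wP b; apply.
by exists g; split=> // b; have [] := wP b.
Qed.

End Cutting.

(** * Markov's inequality, complements and the union bound *)

Section Prob.
Variables (R : realType) (T : finType) (mu : T -> R).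
Hypothesis mu_ge0 : forall a, 0 <= mu a.

Lemma prob_le_expect (E : T -> Prop) (g : T -> R) :
  (forall a, 0 <= g a) -> (forall a, E a -> 1 <= g a) ->
  prob mu E <= \sum_a mu a * g a.
Proof.
move=> g0 g1; rewrite /prob big_mkcond /=; apply: ler_sum => a _.
case: asboolP => [/g1|_]; last by rewrite mulr_ge0.
by move=> ga; rewrite -{1}[mu a]mulr1 ler_wpM2l.
Qed.

Lemma prob_mono (E F : T -> Prop) : (forall a, E a -> F a) -> prob mu E <= prob mu F.
Proof.
move=> EF; rewrite /prob !(big_mkcond (fun a => `[< _ >])) /=.
apply: ler_sum => a _; case: asboolP => [/EF Fa|_]; first by rewrite asboolT.
by case: ifP.
Qed.

Lemma prob_not (E : T -> Prop) : \sum_a mu a = 1 ->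
  prob mu E = 1 - prob mu (fun a => ~ E a).
Proof.
move=> <-; rewrite (bigID (fun a => `[< E a >])) /=.
have -> : prob mu (fun a => ~ E a) = \sum_(a | ~~ `[< E a >]) mu a.
  by apply: eq_bigl => a; rewrite asbool_neg.
by rewrite addrK.
Qed.

Lemma prob_exists_le (J : eqType) (r : seq J) (P : pred J) (E : J -> T -> Prop) :
  prob mu (fun a => exists j, [/\ j \in r, P j & E j a])
  <= \sum_(j <- r | P j) prob mu (E j).
Proof.
rewrite /prob; under [leRHS]eq_bigr do rewrite big_mkcond /=.
rewrite exchange_big big_mkcond /=; apply: ler_sum => a _.
have nn j : 0 <= (if `[< E j a >] then mu a else 0) by case: ifP.
case: asboolP => [[j [jr Pj Ej]]|_]; last by rewrite sumr_ge0.
rewrite big_mkcond /= (big_rem j) //= Pj asboolT // lerDl sumr_ge0 // => i _.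
by case: ifP.
Qed.

End Prob.

(** * Chernoff bounds and conditioning for independent samples *)

Lemma expR_le_quadratic (R : realType) (x : R) :
  x <= 1 / 3 -> expR x <= 1 + x + x ^+ 2.
Proof.
move=> x3; have y0 : 0 < 1 - x / 2 by lra.
have half : expR (x / 2) <= (1 - x / 2)^-1.
  rewrite -[leLHS]invrK -expRN lef_pV2 ?posrE ?expR_gt0 //.
  by have := expR_ge1Dx (- (x / 2)); lra.
have -> : expR x = expR (x / 2) ^+ 2 by rewrite -expRM_natr; congr expR; field.
apply: (@le_trans _ _ ((1 - x / 2)^-1 ^+ 2)).
  by rewrite lerXn2r ?nnegrE ?expR_ge0 // invr_ge0 ltW.
rewrite exprVn -[leLHS]mul1r ler_pdivrMr ?exprn_gt0 //.
(* This is four times [(1 + x + x ^+ 2) * (1 - x / 2) ^+ 2 - 1]. *)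
have : 0 <= x ^+ 2 * (1 - 3 * x + x ^+ 2) by rewrite mulr_ge0 ?sqr_ge0 //; nra.
by nra.
Qed.

Section Sampling.
Variables (R : realType) (I : finType) (mu : I -> R).
Hypotheses (mu_ge0 : forall i, 0 <= mu i) (mu_sum1 : \sum_i mu i = 1).
Implicit Types (D : {set I}) (N : nat).

Definition mass D : R := \sum_(i in D) mu i.

Definition freq N (s : {ffun 'I_N -> I}) D : R :=
  #|[set j | s j \in D]|%:R / N%:R.

Lemma mass_ge0 D : 0 <= mass D.
Proof. exact: sumr_ge0. Qed.

Lemma massC D : mass (~: D) = 1 - mass D.
Proof.
rewrite -mu_sum1 (bigID (mem D)) /= -/(mass D) addrAC subrr add0r.
by apply: eq_bigl => i; rewrite inE.
Qed.

Lemma mass_sub D D' : D \subset D' -> mass D <= mass D'.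
Proof.
move=> DD; rewrite /mass !(big_mkcond (fun i => i \in _)) /=.
apply: ler_sum => i _; case: ifP => [/(subsetP DD)->//|_].
by case: ifP.
Qed.

Lemma mass_le1 D : mass D <= 1.
Proof. by have := mass_ge0 (~: D); rewrite massC subr_ge0. Qed.

Lemma iid_ge0 N (s : {ffun 'I_N -> I}) : 0 <= iid_pmf mu s.
Proof. exact: prodr_ge0. Qed.

Lemma sum_iid_prod N (F : 'I_N -> I -> R) :
  \sum_(s : {ffun 'I_N -> I}) iid_pmf mu s * \prod_j F j (s j)
  = \prod_j \sum_i mu i * F j i.
Proof.
rewrite bigA_distr_bigA; apply: eq_bigr => s _.
by rewrite /iid_pmf -big_split.
Qed.

Lemma iid_sum1 N : \sum_(s : {ffun 'I_N -> I}) iid_pmf mu s = 1.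
Proof.
pose F (_ : 'I_N) (_ : I) : R := 1.
transitivity (\sum_(s : {ffun 'I_N -> I}) iid_pmf mu s * \prod_j F j (s j)).
  by apply: eq_bigr => s _; rewrite big1 ?mulr1.
rewrite sum_iid_prod big1 // => j _.
by under eq_bigr do rewrite mulr1.
Qed.

Lemma freq_mul N (s : {ffun 'I_N -> I}) D : (0 < N)%N ->
  N%:R * freq s D = \sum_j (s j \in D)%:R.
Proof.
move=> N0; rewrite mulrC divfK ?pnatr_eq0 -?lt0n // -sum1dep_card natr_sum.
by rewrite big_mkcond /=; apply: eq_bigr => j _; case: ifP.
Qed.

(** Markov's inequality for an exponential moment; the sign of [x] selects the tail. Keeping [q] in
    the exponent makes sets of small mass deviate less, which chaining exploits. *)
Lemma chernoff N D (x q e : R) : (0 < N)%N -> `|x| <= 1 / 3 -> mass D <= q ->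
  prob (iid_pmf mu (N := N)) (fun s => `|x| * e <= x * (freq s D - mass D))
  <= expR (N%:R * (q * x ^+ 2 - `|x| * e)).
Proof.
move=> N0 x3 Dq.
apply: le_trans (prob_le_expect (@iid_ge0 N) (g := fun s =>
  expR (- (N%:R * (`|x| * e))) * \prod_j expR (x * ((s j \in D)%:R - mass D))) _ _) _.
- by move=> s; rewrite mulr_ge0 ?expR_ge0 // prodr_ge0 // => j _; rewrite expR_ge0.
- move=> s Es; rewrite -expR_sum -expRD -[leLHS]expR0 ler_expR.
  rewrite -mulr_sumr sumrB sumr_const card_ord -freq_mul //.
  rewrite addrC subr_ge0 -[mass D *+ N]mulr_natl -mulrBr [leRHS]mulrCA.
  by rewrite ler_wpM2l ?ler0n.
under eq_bigr do rewrite mulrCA.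
rewrite -mulr_sumr (sum_iid_prod (fun (_ : 'I_N) i => expR (x * ((i \in D)%:R - mass D)))).
rewrite prodr_const card_ord.
have one : \sum_i mu i * expR (x * ((i \in D)%:R - mass D)) <= expR (q * x ^+ 2).
  have -> : \sum_i mu i * expR (x * ((i \in D)%:R - mass D))
      = expR (- (x * mass D)) * (1 + mass D * (expR x - 1)).
    rewrite -[X in X + _]mu_sum1 [in X in _ + X]/mass mulr_suml.
    rewrite (big_mkcond (fun i => i \in D)) /= -big_split /=.
    rewrite mulr_sumr; apply: eq_bigr => i _.
    rewrite mulrBr addrC expRD; case: ifP => _; rewrite ?mulr0 ?mulr1 ?expR0; ring.
  apply: (@le_trans _ _ (expR (- (x * mass D)) * expR (mass D * (expR x - 1)))).
    by rewrite ler_wpM2l ?expR_ge0 // expR_ge1Dx.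
  rewrite -expRD ler_expR.
  have m0 := mass_ge0 D.
  apply: (@le_trans _ _ (mass D * x ^+ 2)); last by rewrite ler_wpM2r ?sqr_ge0.
  have : mass D * (expR x - 1 - x) <= mass D * x ^+ 2.
    rewrite ler_wpM2l //.
    have /expR_le_quadratic : x <= 1 / 3 by exact: le_trans (ler_norm x) x3.
    by lra.
  by rewrite mulrBr; lra.
rewrite mulrBr expRD mulrC ler_wpM2r ?expR_ge0 //.
rewrite mulrC expRM_natr lerXn2r ?nnegrE ?expR_ge0 //.
by apply: sumr_ge0 => i _; rewrite mulr_ge0 ?expR_ge0.
Qed.

(* Conditionally on the samples indexed by [J], the set [M s] is fixed and the
   other samples are independent of it. *)
Lemma prob_avoid N (J : {set 'I_N}) (M : {ffun 'I_N -> I} -> {set I}) (q : R) :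
  q <= 1 ->
  (forall s s' : {ffun 'I_N -> I}, (forall j, j \in J -> s j = s' j) -> M s = M s') ->
  prob (iid_pmf mu (N := N))
    (fun s => q < mass (M s) /\ forall j, s j \notin M s)
  <= (1 - q) ^+ #|~: J|.
Proof.
move=> q1 MJ.
(* Partitioning by [mask] amounts to conditioning on the samples indexed by [J]. *)
pose mask (s : {ffun 'I_N -> I}) := [ffun j => if j \in J then Some (s j) else None].
have maskP s s' : mask s = mask s' -> forall j, j \in J -> s j = s' j.
  by move=> /ffunP e j jJ; have := e j; rewrite !ffunE jJ => -[].
rewrite /prob (partition_big mask predT) //=.
have -> : (1 - q) ^+ #|~: J|
    = \sum_a (1 - q) ^+ #|~: J| * \sum_(s | mask s == a) iid_pmf mu s.
  rewrite -mulr_sumr -[LHS]mulr1; congr (_ * _).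
  by rewrite -(iid_sum1 N) (partition_big mask predT).
apply: ler_sum => a _.
have [[s0 [qM avoid] <-{a}]|no] := pselect (exists2 s0, q < mass (M s0) /\
    (forall j, s0 j \notin M s0) & mask s0 = a); last first.
  rewrite big_pred0 ?mulr_ge0 ?exprn_ge0 ?subr_ge0 ?sumr_ge0 // => [s _|s].
    exact: iid_ge0.
  by apply/negP => /andP[/asboolP Es /eqP ma]; apply: no; exists s.
(* The product of the [G j] indicates agreement with [s0] on [J]; that of the [F j] also asks the
   other samples to avoid [M s0]. Both factor over coordinates. *)
pose G (j : 'I_N) (i : I) : R := if j \in J then (i == s0 j)%:R else 1.
pose F (j : 'I_N) (i : I) : R := if j \in J then (i == s0 j)%:R else (i \notin M s0)%:R.
have G_ge0 j i : 0 <= G j i by rewrite /G; case: ifP.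
have F_ge0 j i : 0 <= F j i by rewrite /F; case: ifP.
have -> : \sum_(s | mask s == mask s0) iid_pmf mu s
    = \sum_(s : {ffun 'I_N -> I}) iid_pmf mu s * \prod_j G j (s j).
  rewrite big_mkcond /=; apply: eq_bigr => s _; case: ifP => [/eqP/maskP ms|/eqP ms].
    by rewrite big1 ?mulr1 // => j _; rewrite /G; case: ifP => // /ms ->; rewrite eqxx.
  have [j jP] : exists j, ~~ ((j \in J) ==> (s j == s0 j)).
    apply/existsP; rewrite -negb_forall; apply/negP => /forallP e; apply: ms.
    apply/ffunP => j; rewrite !ffunE; case: ifP => // jJ.
    by have := e j; rewrite jJ => /eqP ->.
  move: jP; rewrite negb_imply => /andP[jJ /negbTE sj].
  by rewrite (bigD1 j) //= /G jJ sj mul0r mulr0.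
apply: (@le_trans _ _ (\sum_(s : {ffun 'I_N -> I}) iid_pmf mu s * \prod_j F j (s j))).
  rewrite big_mkcond /=; apply: ler_sum => s _.
  case: ifP => [/andP[/asboolP[_ av] /eqP/maskP ms]|_]; last first.
    by rewrite mulr_ge0 ?iid_ge0 // prodr_ge0.
  rewrite [X in _ * X]big1 ?mulr1 // => j _; rewrite /F.
  by case: ifP => [/ms ->|_]; rewrite ?eqxx // -(MJ _ _ ms) av.
rewrite !sum_iid_prod.
have FG j : \sum_i mu i * F j i
    = (\sum_i mu i * G j i) * (if j \in ~: J then 1 - mass (M s0) else 1).
  rewrite /F /G inE; case: (j \in J) => /=; first by rewrite mulr1.
  have -> : \sum_i mu i * 1 = 1 by under eq_bigr do rewrite mulr1.
  rewrite mul1r -massC /mass [RHS]big_mkcond /=; apply: eq_bigr => i _.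
  by rewrite inE; case: ifP; rewrite ?mulr1 ?mulr0.
under eq_bigr do rewrite FG.
rewrite big_split /= mulrC -big_mkcond /= prodr_const ler_wpM2r //.
  by apply: prodr_ge0 => j _; apply: sumr_ge0 => i _; rewrite mulr_ge0.
by rewrite lerXn2r ?nnegrE ?subr_ge0 ?mass_le1 // lerD2l lerN2 ltW.
Qed.
End Sampling.

(** * Brackets for half-spaces from an epsilon-net *)

Section Bracketing.
Variables (R : realType) (I : finType) (mu : I -> R) (y : I -> R * R * R).
Hypotheses (mu_ge0 : forall i, 0 <= mu i) (mu_sum1 : \sum_i mu i = 1).

Definition halfspace (h : R * R * R) : {set I} := [set i | dot3 h (y i) <= 0].

Section Net.
Variable k : nat.
Notation index := ('I_k + 'I_3)%type.
Notation code := {ffun bool * bool -> index * index * bool}.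
Implicit Types (s : {ffun 'I_k -> I}) (c : code).

(* The coordinate axes make every cell of the arrangement a pointed cone. *)
Definition net_vector s (x : index) : R * R * R :=
  match x with
  | inl j => y (s j)
  | inr i => ((i == 0 :> nat)%:R, (i == 1 :> nat)%:R, (i == 2 :> nat)%:R)
  end.

Definition below s c : {set I} :=
  [set i | [forall b, dot3 (vertex (net_vector s) (c b)) (y i) <= 0]].

Definition mixed s c : {set I} :=
  [set i | [exists b, dot3 (vertex (net_vector s) (c b)) (y i) < 0] &&
           [exists b, 0 < dot3 (vertex (net_vector s) (c b)) (y i)]].

(** The code names the four vertices of [cell_cutting]. They lie in the closed cell of [h], so no
    sample sees both strict signs. A point of the half-space outside [below] has a positive vertex,
    hence also a negative one. *)
Lemma halfspace_code s h : h != 0 -> exists c,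
  [/\ forall j, s j \notin mixed s c, below s c \subset halfspace h
    & halfspace h \subset below s c :|: mixed s c].
Proof.
move=> h0.
have [|||w [wc wn wp]] := @cell_cutting R _ (net_vector s) (inr (Ordinal (isT : (0 < 3)%N)))
  (inr (Ordinal (isT : (1 < 3)%N))) (inr (Ordinal (isT : (2 < 3)%N))) _ _ _ h h0 => //.
exists (finfun w); split.
- move=> j; rewrite inE; apply/negP => /andP[/existsP[b]]; rewrite ffunE => bn.
  move=> /existsP[b']; rewrite ffunE => bp.
  have [p n z] := wc b (inl j); have [p' n' z'] := wc b' (inl j).
  case: (ltgtP (dot3 h (net_vector s (inl j))) 0) => [/n'|/p|/z] /=.
  + by rewrite leNgt bp.
  + by rewrite leNgt bn.
  + by move=> e; move: bn; rewrite e ltxx.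
- apply/subsetP => i; rewrite !inE => /forallP le; apply: wn => b.
  by have := le b; rewrite ffunE.
- apply/subsetP => i; rewrite !inE => hi.
  case: (boolP [forall b, _]) => //=; rewrite negb_forall => /existsP[b].
  rewrite -ltNge => bp; apply/andP; split; last by apply/existsP; exists b.
  apply: contraTT hi; rewrite negb_exists => /forallP ge; rewrite -ltNge.
  apply: (wp _ b) => [b'|]; last by rewrite ffunE in bp.
  by have := ge b'; rewrite -leNgt ffunE.
Qed.

Definition code_support c : {set 'I_k} :=
  [set j | [exists b, ((c b).1.1 == inl j) || ((c b).1.2 == inl j)]].

(** Four vertices, each spanned by two planes. *)
Lemma card_code_support c : (#|code_support c| <= 8)%N.
Proof.
pose f (p : bool * bool * bool) := if p.2 then (c p.1).1.1 else (c p.1).1.2.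
have inj : injective (inl : 'I_k -> index) by move=> a b [].
rewrite -(card_imset _ inj).
have sub : [set (inl j : index) | j in code_support c]
    \subset [set f p | p in [set: bool * bool * bool]].
  apply/subsetP => x /imsetP[j]; rewrite inE => /existsP[b /orP[]/eqP e] ->.
    by apply/imsetP; exists (b, true); rewrite ?inE.
  by apply/imsetP; exists (b, false); rewrite ?inE.
apply: leq_trans (subset_leq_card sub) (leq_trans (leq_imset_card _ _) _).
by rewrite cardsT !card_prod card_bool.
Qed.

Lemma mixed_support s s' c :
  (forall j, j \in code_support c -> s j = s' j) -> mixed s c = mixed s' c.
Proof.
move=> ss; suff e b : vertex (net_vector s) (c b) = vertex (net_vector s') (c b).
  by apply/setP => i; rewrite !inE; under eq_existsb do rewrite e;
     under [in X in _ && X]eq_existsb do rewrite e.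
rewrite /vertex; congr (move3 _ _ (cross3 _ _)).
  case e : (c b).1.1 => [j|//] /=; rewrite ss // inE; apply/existsP; exists b.
  by rewrite e eqxx.
case e : (c b).1.2 => [j|//] /=; rewrite ss // inE; apply/existsP; exists b.
by rewrite e eqxx orbT.
Qed.

(** The probabilistic method. The mixed region of a code depends on at most 8 samples, and the
    others all avoid it with probability at most [(1 - q) ^+ (k - 8)] when its mass exceeds [q]; a
    union bound over codes concludes. *)
Lemma exists_net (q : R) : 0 <= q <= 1 -> #|code|%:R * (1 - q) ^+ (k - 8) < 1 ->
  exists s, forall c, (forall j, s j \notin mixed s c) -> mass mu (mixed s c) <= q.
Proof.
move=> /andP[q0 q1] small; apply: contrapT => /forallNP no.
pose bad c s := q < mass mu (mixed s c) /\ forall j, s j \notin mixed s c.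
have tot : prob (iid_pmf mu (N := k))
    (fun s => exists c, [/\ c \in enum {: code}, predT c & bad c s]) = 1.
  rewrite -(iid_sum1 mu_sum1 k); apply: eq_bigl => s; apply/asboolP.
  have := no s; move=> /existsNP[c]; rewrite not_implyE => -[av /negP].
  by rewrite -ltNge => gt; exists c; rewrite mem_enum.
suff : 1 <= #|code|%:R * (1 - q) ^+ (k - 8) by rewrite leNgt small.
rewrite -[leLHS]tot; apply: le_trans (prob_exists_le _ _ _ _) _ => [s|].
  exact: iid_ge0.
rewrite big_enum /= mulr_natl -sumr_const; apply: ler_sum => c _.
apply: le_trans (prob_avoid mu_ge0 mu_sum1 (J := code_support c) q1 _) _.
  by move=> s s'; apply: mixed_support.
apply: ler_wiXn2l; rewrite ?subr_ge0 // ?gerBl //.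
by rewrite cardsCs setCK card_ord leq_sub2l // card_code_support.
Qed.

End Net.

Lemma one_sub_inv_exp (r : nat) : (0 < r)%N -> (1 - r%:R^-1 : R) ^+ r <= 1 / 2.
Proof.
move=> r0; have r0' : (0 : R) < r%:R by rewrite ltr0n.
have r1 : 0 <= 1 - (r%:R : R)^-1 by rewrite subr_ge0 invf_le1 // ler1n.
apply: (@le_trans _ _ (expR (- r%:R^-1) ^+ r)).
  by rewrite lerXn2r ?nnegrE ?expR_ge0 // expR_ge1Dx.
rewrite -expRM_natr mulNr mulVf ?gt_eqF // expRN div1r lef_pV2 ?posrE ?expR_gt0 //.
by have := expR_ge1Dx (1 : R); lra.
Qed.

Lemma bracketing j : exists F : seq ({set I} * {set I}),
  [/\ (size F)%:R <= 2 ^+ (60 + 40 * j) :> R,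
      forall p, p \in F -> mass mu (p.2 :\: p.1) <= 16 ^- j
    & forall h, h != 0 ->
        exists2 p, p \in F & p.1 \subset halfspace h /\ halfspace h \subset p.2].
Proof.
(* With [q = 16 ^- j], the avoidance probability is at most [2 ^- m], and [m] exceeds the exponent
   [60 + 40 * j] that bounds the number of codes. *)
pose m := (80 * j.+1)%N; pose k := (16 ^ j * m + 8)%N.
pose code := {ffun bool * bool -> ('I_k + 'I_3) * ('I_k + 'I_3) * bool}.
have k3 : (k + 3 <= 2 ^ (7 + 5 * j))%N.
  have j2 : (j.+1 <= 2 ^ j)%N by apply: ltn_expl.
  have p0 : (0 < 16 ^ j)%N by rewrite expn_gt0.
  have p1 : (0 < 2 ^ j)%N by rewrite expn_gt0.
  rewrite /k /m expnD expnM (_ : 2 ^ 5 = 16 * 2)%N // expnMn.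
  by move: (16 ^ j)%N (2 ^ j)%N p0 p1 j2 => a b a0 b0 jb; nia.
have card : (#|{: code}| <= 2 ^ (60 + 40 * j))%N.
  rewrite card_ffun !card_prod card_sum !card_ord card_bool.
  apply: (@leq_trans ((2 ^ (7 + 5 * j) * 2 ^ (7 + 5 * j) * 2) ^ (2 * 2))%N).
    by rewrite leq_exp2r // leq_mul2r leq_mul.
  by rewrite -!expnD -expnSr -expnM leq_exp2l //; lia.
have cardR : #|{: code}|%:R <= 2 ^+ (60 + 40 * j) :> R.
  by rewrite -natrX ler_nat.
have [||s sP] := @exists_net k (16 ^- j).
- by rewrite invr_ge0 exprn_ge0 //= invf_le1 ?exprn_gt0 // exprn_ege1 // ler1n.
- apply: (@le_lt_trans _ _ (2 ^+ (60 + 40 * j) * (1 / 2) ^+ m)).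
    rewrite ler_pM ?exprn_ge0 //.
      by rewrite subr_ge0 invf_le1 ?exprn_gt0 // exprn_ege1 // ler1n.
    rewrite addnK exprM lerXn2r ?nnegrE ?exprn_ge0 //.
      by rewrite subr_ge0 invf_le1 ?exprn_gt0 // exprn_ege1 // ler1n.
      by rewrite divr_ge0.
    by rewrite -natrX one_sub_inv_exp // expn_gt0.
  rewrite expr_div_n expr1n div1r ltr_pdivrMr ?exprn_gt0 // mul1r.
  by rewrite ltr_eXn2l // ?ltr1n // /m; lia.
pose br (c : code) := (below s c, below s c :|: mixed s c).
have brD c : (br c).2 :\: (br c).1 \subset mixed s c.
  by rewrite setDUl setDv set0U subsetDl.
exists [seq br c | c <- enum {: code} & mass mu (mixed s c) <= 16 ^- j]; split.
- apply: le_trans cardR; rewrite ler_nat size_map size_filter cardE.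
  exact: count_size.
- move=> p /mapP[c]; rewrite mem_filter => /andP[cm _] ->.
  exact: le_trans (mass_sub mu_ge0 (brD c)) cm.
- move=> h /(halfspace_code s)[c [av lo up]]; exists (br c) => //.
  by apply: map_f; rewrite mem_filter mem_enum sP.
Qed.

End Bracketing.

(** * Chaining along the brackets *)

Section UniformDeviation.
Variables (R : realType) (I : finType) (mu : I -> R) (y : I -> R * R * R).
Hypotheses (mu_ge0 : forall i, 0 <= mu i) (mu_sum1 : \sum_i mu i = 1).
Implicit Types (A B D H : {set I}).

Lemma massID A B : mass mu A = mass mu (A :&: B) + mass mu (A :\: B).
Proof. exact: big_setID. Qed.

Variable N : nat.
Implicit Types (s : {ffun 'I_N -> I}).

Lemma freqID s A B : freq R s A = freq R s (A :&: B) + freq R s (A :\: B).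
Proof.
rewrite /freq -mulrDl -natrD; congr (_%:R / _).
rewrite -[LHS](cardsID [set j | s j \in B]).
have -> : [set j | s j \in A] :&: [set j | s j \in B] = [set j | s j \in A :&: B].
  by apply/setP => j; rewrite !inE.
suff -> : [set j | s j \in A] :\: [set j | s j \in B] = [set j | s j \in A :\: B] by [].
by apply/setP => j; rewrite !inE.
Qed.

Lemma freq_ge0 s A : 0 <= freq R s A.
Proof. by rewrite divr_ge0. Qed.

Lemma freq_sub s A B : A \subset B -> freq R s A <= freq R s B.
Proof. by move=> /setIidPr AB; rewrite (freqID s B A) AB lerDl freq_ge0. Qed.

Definition dev s A : R := freq R s A - mass mu A.

Lemma dev_set0 s : dev s set0 = 0.
Proof.
rewrite /dev /freq /mass big_set0 subr0 (_ : [set j | s j \in set0] = set0).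
  by rewrite cards0 mul0r.
by apply/setP => j; rewrite !inE.
Qed.

Lemma dev_diff s A B : dev s B - dev s A = dev s (B :\: A) - dev s (A :\: B).
Proof.
rewrite /dev (freqID s A B) (freqID s B A) (massID A B) (massID B A).
by rewrite (setIC B A); ring.
Qed.

Section Chain.
Variable F : nat -> seq ({set I} * {set I}).
Hypothesis F0 : F 0 = [:: (set0, setT)].
Hypothesis F_size : forall j, (size (F j))%:R <= 2 ^+ (60 + 40 * j) :> R.
Hypothesis F_mass : forall j p, p \in F j -> mass mu (p.2 :\: p.1) <= 16 ^- j.
Variable good_set : {set I} -> Prop.
Hypothesis F_bracket : forall j H, good_set H ->
  exists p, [/\ p \in F j, p.1 \subset H & H \subset p.2].

(** Every set whose deviation a chain may use at level [j]: differences of successive lower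
    brackets, both ways, and bracket gaps. The mass filter makes the Chernoff bound of the level
    apply to all of them. *)
Definition links j : seq {set I} :=
  [seq D <- [seq q.1 :\: p.1 | p <- F j, q <- F j.+1]
         ++ [seq p.1 :\: q.1 | p <- F j, q <- F j.+1]
         ++ [seq p.2 :\: p.1 | p <- F j] | mass mu D <= 16 ^- j].

Lemma size_links j : (size (links j))%:R <= 2 ^+ (162 + 80 * j) :> R.
Proof.
have a0 : (0 : R) <= (size (F j))%:R by [].
have a1 := F_size j; have b1 := F_size j.+1.
have ab : (size (F j))%:R * (size (F j.+1))%:R <= 2 ^+ (160 + 80 * j) :> R.
  apply: (@le_trans _ _ (2 ^+ (60 + 40 * j) * 2 ^+ (60 + 40 * j.+1))).
    by rewrite ler_pM.
  by rewrite -exprD ler_eXn2l ?ltr1n //; lia.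
have a2 : (size (F j))%:R <= 2 ^+ (160 + 80 * j) :> R.
  by apply: le_trans a1 _; rewrite ler_eXn2l ?ltr1n //; lia.
apply: (@le_trans _ _ ((size (F j) * size (F j.+1)
    + (size (F j) * size (F j.+1) + size (F j)))%N)%:R).
  rewrite ler_nat size_filter; apply: leq_trans (count_size _ _) _.
  by rewrite !size_cat !size_allpairs size_map.
rewrite !natrD natrM (_ : 162 + 80 * j = 2 + (160 + 80 * j))%N; last by lia.
by rewrite exprD; move: (2 ^+ (160 + 80 * j)) ab a2 => X ab a2; lra.
Qed.

Variable e : R.
Hypothesis e_gt0 : 0 < e.

(** Summable over levels, yet large against the scale [4 ^- j] of the standard deviation at mass
    [16 ^- j], so the Chernoff exponents grow like [4 ^+ j]. *)
Definition tol j : R := e / 128 / 2 ^+ j.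

(** Telescope from the empty set to the lower bracket at level [K]. Then [H] is squeezed between the
    two brackets, whose gap has mass at most [e / 4] and small deviation. *)
Lemma chaining K s : 16 ^- K <= e / 4 ->
  (forall j D, (j <= K)%N -> D \in links j -> `|dev s D| <= tol j) ->
  forall H, good_set H -> `|dev s H| <= e.
Proof.
move=> Ke good H gH.
have /choice[p pP] j := F_bracket j gH.
pose A j := (p j).1; pose B j := (p j).2.
have BA j : mass mu (B j :\: A j) <= 16 ^- j by have [/F_mass] := pP j.
have AH j : A j \subset H by have [] := pP j.
have HB j : H \subset B j by have [] := pP j.
have A0 : A 0%N = set0 by have [+ _ _] := pP 0%N; rewrite /A F0 inE => /eqP ->.
have mon i j : (i <= j)%N -> 16 ^- j <= 16 ^- i :> R.
  by move=> ij; rewrite lef_pV2 ?posrE ?exprn_gt0 // ler_weXn2l // ler1n.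
have step j : (j < K)%N -> `|dev s (A j.+1) - dev s (A j)| <= 2 * tol j.
  move=> jK; rewrite dev_diff; apply: le_trans (ler_normB _ _) _.
  (* Lower brackets lie in [H], hence in every upper bracket, so both differences sit inside a
     bracket gap. *)
  have m1 : mass mu (A j.+1 :\: A j) <= 16 ^- j.
    by apply: le_trans (BA j); apply: mass_sub => //; rewrite setSD // (subset_trans (AH _)).
  have m2 : mass mu (A j :\: A j.+1) <= 16 ^- j.
    apply: le_trans (mon _ _ (leqnSn j)); apply: le_trans (BA j.+1).
    by apply: mass_sub => //; rewrite setSD // (subset_trans (AH _)).
  have [pj _ _] := pP j; have [pj1 _ _] := pP j.+1.
  have d1 : A j.+1 :\: A j \in links j.
    by rewrite mem_filter m1 mem_cat; apply/orP; left; apply/allpairsP; exists (p j, p j.+1).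
  have d2 : A j :\: A j.+1 \in links j.
    rewrite mem_filter m2 !mem_cat; apply/orP; right; apply/orP; left.
    by apply/allpairsP; exists (p j, p j.+1).
  have := good _ _ (ltnW jK) d1; have := good _ _ (ltnW jK) d2; lra.
(* The right-hand side is the sum of [2 * tol i] over [i < j]. *)
have dA j : (j <= K)%N -> `|dev s (A j)| <= 4 * (e / 128) * (1 - 2 ^- j).
  elim: j => [_|j IH jK].
    by rewrite A0 dev_set0 normr0 expr0 invr1 subrr mulr0.
  have := step _ jK; have := IH (ltnW jK); rewrite /tol exprS invfM.
  move: (dev s (A j)) (dev s _) => u v; rewrite !ler_norml => /andP[] ? ? /andP[] ? ?.
  apply/andP; split; lra.
have dBA : `|dev s (B K :\: A K)| <= tol K.
  apply: (good _ _ (leqnn K)); rewrite mem_filter BA !mem_cat.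
  by apply/orP; right; apply/orP; right; apply/mapP; exists (p K) => //; have [] := pP K.
have tolK : tol K <= e / 128.
  have e0 := ltW e_gt0.
  rewrite /tol ler_pdivrMr ?exprn_gt0 // ler_peMr ?divr_ge0 //.
  by rewrite exprn_ege1 // ler1n.
have sK : 4 * (e / 128) * (1 - 2 ^- K) <= e / 32.
  have : (0 : R) <= 2 ^- K by rewrite invr_ge0 exprn_ge0.
  by move: (2 ^- K) => c; have := e_gt0; nra.
have AB : A K \subset B K by exact: subset_trans (AH K) (HB K).
have fH := freq_sub s (HB K); have fA := freq_sub s (AH K).
have mH := mass_sub mu_ge0 (HB K); have mA := mass_sub mu_ge0 (AH K).
have fB := freqID s (B K) (A K); have mB := massID (B K) (A K).
rewrite (setIidPr AB) in fB mB.
have := dA _ (leqnn K); have := BA K; move: dBA fH fA mH mA fB mB.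
rewrite /dev !ler_norml.
move=> /andP[? ?] ? ? ? ? ? ? ? /andP[? ?]; apply/andP; split; lra.
Qed.

Lemma prob_link j D : (0 < N)%N -> e * 16 ^+ j <= 64 -> mass mu D <= 16 ^- j ->
  prob (iid_pmf mu (N := N)) (fun s => ~ (`|dev s D| <= tol j))
  <= 2 * expR (- (N%:R * e ^+ 2 / 256 ^+ 2 * 4 ^+ j)).
Proof.
(* This [x] minimizes [16 ^- j * x ^+ 2 - x * tol j], and [e * 16 ^+ j <= 64] keeps it at most
   [1 / 4]. *)
move=> N0 e64 Dj; pose x := e * 8 ^+ j / 256.
have x0 : 0 < x by rewrite divr_gt0 // mulr_gt0 // exprn_gt0.
have x3 : x <= 1 / 3.
  have : e * 8 ^+ j <= e * 16 ^+ j.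
    by rewrite ler_wpM2l ?(ltW e_gt0) // lerXn2r ?nnegrE // ler_nat.
  by rewrite /x; lra.
have one (b : bool) : prob (iid_pmf mu (N := N)) (fun s =>
    `|(-1) ^+ b * x| * tol j <= (-1) ^+ b * x * dev s D)
    <= expR (- (N%:R * e ^+ 2 / 256 ^+ 2 * 4 ^+ j)).
  apply: le_trans (chernoff mu_ge0 mu_sum1 _ N0 _ Dj) _.
    by rewrite normrMsign gtr0_norm.
  rewrite ler_expR normrMsign gtr0_norm // exprMn sqrr_sign mul1r /x /tol.
  have pow2 m : (2 ^ m)%:R ^+ j = (2 ^+ j) ^+ m :> R.
    by rewrite natrX -!exprM mulnC.
  rewrite (pow2 4%N) (pow2 3%N) (pow2 2%N).
  have : (2 ^+ j : R) != 0 by rewrite expf_eq0 pnatr_eq0 andbF.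
  by move: (2 ^+ j) => a a0; rewrite le_eqVlt; apply/orP; left; apply/eqP; field.
apply: le_trans (prob_mono (@iid_ge0 _ _ _ mu_ge0 N) (F := fun s => exists b : bool,
  [/\ b \in [:: false; true], predT b &
    `|(-1) ^+ b * x| * tol j <= (-1) ^+ b * x * dev s D]) _) _.
  move=> s /negP; rewrite -ltNge => big; exists (dev s D < 0); split=> //.
    by case: (dev s D < 0).
  rewrite normrMsign gtr0_norm // [leRHS]mulrAC [leRHS]mulrC ler_wpM2l ?(ltW x0) //.
  by rewrite -normrEsign ltW.
apply: le_trans (prob_exists_le (@iid_ge0 _ _ _ mu_ge0 N) _ _ _) _.
rewrite !big_cons big_nil /= addr0 mulr_natl mulr2n.
by apply: lerD; [exact: (one false)|exact: (one true)].
Qed.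

(** Since [4 ^+ j >= j + 1], each link fails with probability at most twice
    [expR (- L) ^+ (200 * j.+1)]. One factor yields [d]; the others, each at most [1 / 2], outweigh
    the number of links. *)
Lemma prob_bad_level j (L d : R) : (0 < N)%N -> e * 16 ^+ j <= 64 ->
  expR (- L) <= 1 / 2 -> expR (- L) <= d -> 200 * 256 ^+ 2 * L <= N%:R * e ^+ 2 ->
  prob (iid_pmf mu (N := N)) (fun s => exists D,
    [/\ D \in links j, predT D & ~ (`|dev s D| <= tol j)]) <= d / 2 ^+ j.+1.
Proof.
move=> N0 e64 L2 Ld NL.
apply: le_trans (prob_exists_le (@iid_ge0 _ _ _ mu_ge0 N) _ _ _) _.
apply: (@le_trans _ _ (\sum_(D <- links j) 2 * expR (- (N%:R * e ^+ 2 / 256 ^+ 2 * 4 ^+ j)))).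
  rewrite !big_seq; apply: ler_sum => D; rewrite mem_filter => /andP[Dj _].
  exact: prob_link.
have L0 : 0 <= L.
  by rewrite -oppr_le0 -ler_expR expR0; apply: le_trans L2 _; lra.
have j4 : (j.+1)%:R <= 4 ^+ j :> R by rewrite -natrX ler_nat ltn_expl.
have E0 := expR_ge0 (- L).
have tail : expR (- (N%:R * e ^+ 2 / 256 ^+ 2 * 4 ^+ j)) <= d * (1 / 2) ^+ (199 + 200 * j).
  apply: (@le_trans _ _ (expR (- L) ^+ (200 * j.+1))).
    rewrite -expRM_natr ler_expR mulNr lerN2 natrM mulrA ler_pM ?mulr_ge0 //.
    by lra.
  rewrite (_ : 200 * j.+1 = 1 + (199 + 200 * j))%N; last by lia.
  by rewrite exprD expr1 ler_pM ?exprn_ge0 // lerXn2r ?nnegrE ?divr_ge0.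
have d0 : 0 <= d := le_trans E0 Ld.
rewrite big_const_seq count_predT iter_addr_0 -[_ *+ size _]mulr_natr.
apply: (@le_trans _ _ (2 * (d * (1 / 2) ^+ (199 + 200 * j)) * 2 ^+ (162 + 80 * j))).
  rewrite ler_pM ?mulr_ge0 ?expR_ge0 // ?size_links //.
  by rewrite ler_wpM2l.
have -> : 2 * (d * (1 / 2) ^+ (199 + 200 * j)) * 2 ^+ (162 + 80 * j)
    = d * (2 ^+ (163 + 80 * j) / 2 ^+ (199 + 200 * j)).
  rewrite expr_div_n expr1n div1r (exprS _ (162 + 80 * j)).
  by move: (2 ^+ _) (_^-1) => *; ring.
rewrite ler_wpM2l // ler_pdivrMr ?exprn_gt0 // [leRHS]mulrC ler_pdivlMr ?exprn_gt0 //.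
by rewrite -exprD ler_eXn2l ?ltr1n //; lia.
Qed.

End Chain.

Lemma uniform_deviation (e L d : R) : (0 < N)%N -> 0 < e <= 1 ->
  expR (- L) <= 1 / 2 -> expR (- L) <= d -> 200 * 256 ^+ 2 * L <= N%:R * e ^+ 2 ->
  1 - d <= prob (iid_pmf mu (N := N)) (fun s => forall h, h != 0 ->
    `|dev s (halfspace y h)| <= e).
Proof.
move=> N0 /andP[e0 e1] L2 Ld NL.
have /choice[F0 F0P] := bracketing y mu_ge0 mu_sum1.
(* The trivial bracket at level 0 starts every chain at [set0], whose deviation is 0. *)
pose F j := if j is 0 then [:: (set0, setT)] else F0 j.
pose good_set H := exists2 h, h != 0 & H = halfspace y h.
have F_size j : (size (F j))%:R <= 2 ^+ (60 + 40 * j) :> R.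
  case: j => [|j] /=; first by rewrite exprn_ege1 // ler1n.
  by have [] := F0P j.+1.
have F_mass j p : p \in F j -> mass mu (p.2 :\: p.1) <= 16 ^- j.
  case: j => [|j]; last by have [_ + _] := F0P j.+1; apply.
  by rewrite expr0 invr1 => _; apply: mass_le1.
have F_bracket j H : good_set H -> exists p, [/\ p \in F j, p.1 \subset H & H \subset p.2].
  case: j => [|j] [h h0 ->].
    by exists (set0, setT); rewrite inE eqxx sub0set subsetT.
  by have [_ _ /(_ h h0)[p pF [pl pu]]] := F0P j.+1; exists p.
(* The least [K] with [4 / e <= 16 ^+ K]; minimality costs at most one factor 16, whence 64. *)
have [K Ke K64] : exists2 K, 16 ^- K <= e / 4 & e * 16 ^+ K <= 64.
  have ex : exists k, 4 / e <= 16 ^+ k.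
    exists (Num.truncn (4 / e)).+1; apply: ltW; apply: (lt_le_trans (truncnS_gt _)).
    by rewrite -natrX ler_nat ltnW // ltn_expl.
  case: (ex_minnP ex) => K; rewrite ler_pdivrMr // => K4 Kmin; exists K.
    by rewrite invf_ple ?posrE ?exprn_gt0 ?divr_gt0 // invf_div ler_pdivrMr.
  case: K K4 Kmin => [_ _|K _ Kmin]; first by rewrite expr0; lra.
  have : ~~ (4 / e <= 16 ^+ K) by apply/negP => /Kmin; rewrite ltnn.
  by rewrite -ltNge ltr_pdivlMr // exprS; lra.
rewrite (prob_not _ (iid_sum1 mu_sum1 N)) lerB //.
pose bad j (s : {ffun 'I_N -> I}) := exists D,
  [/\ D \in links F j, predT D & ~ (`|dev s D| <= tol e j)].
apply: le_trans (prob_mono (@iid_ge0 _ _ _ mu_ge0 N) (F := fun s => exists j,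
  [/\ j \in iota 0 K.+1, predT j & bad j s]) _) _.
  move=> s /existsNP[h /not_implyP[h0 big]]; apply: contrapT => /forallNP no.
  apply: big; apply: (chaining (erefl : F 0 = _) F_mass F_bracket e0 Ke); last by exists h.
  move=> j D jK Dj; apply: contrapT => nd; apply: (no j); split=> //; last by exists D.
  by rewrite mem_iota add0n ltnS.
apply: le_trans (prob_exists_le (@iid_ge0 _ _ _ mu_ge0 N) _ _ _) _.
have d0 : 0 <= d := le_trans (expR_ge0 _) Ld.
apply: (@le_trans _ _ (\sum_(0 <= j < K.+1) d / 2 ^+ j.+1)).
  rewrite /index_iota subn0 !big_seq; apply: ler_sum => j; rewrite mem_iota add0n ltnS => jK.
  apply: (prob_bad_level F_size e0 N0 _ L2 Ld NL).
  by apply: le_trans K64; rewrite ler_wpM2l ?(ltW e0) // ler_weXn2l // ler1n.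
have geo : forall n, \sum_(0 <= j < n) d / 2 ^+ j.+1 = d * (1 - 2 ^- n).
  elim=> [|n IH]; first by rewrite big_geq // expr0 invr1 subrr mulr0.
  by rewrite big_nat_recr //= IH exprS invfM; field; rewrite expf_eq0 pnatr_eq0 andbF.
by rewrite geo ler_piMr // gerBl invr_ge0 exprn_ge0.
Qed.

End UniformDeviation.

(** * Width as the spread of projections *)

Section Support.
Variable R : realType.
Implicit Types (u q : 'rV[R]_2) (P : seq 'rV[R]_2).

Lemma dotpNl u q : dotp (- u) q = - dotp u q.
Proof. by rewrite /dotp -sumrN; apply: eq_bigr => i _; rewrite mxE mulNr. Qed.

Lemma suppP P u : P != [::] -> exists2 q, q \in P &
  supp P u = dotp u q /\ forall q', q' \in P -> dotp u q' <= supp P u.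
Proof.
case: P => // q P _ /=; elim: P => [|w P [z zP [zE zmax]]].
  by exists q; rewrite ?inE // big_nil; split=> // q'; rewrite inE => /eqP ->.
rewrite big_cons; have [wz|zw] := leP (dotp u w) (\big[Num.max/dotp u q]_(v <- P) dotp u v).
  exists z; first by move: zP; rewrite !inE => /orP[->//|->]; rewrite !orbT.
  by split=> // q'; rewrite !inE => /or3P[qq|/eqP->//|qq]; apply: zmax; rewrite inE qq ?orbT.
exists w; first by rewrite !inE eqxx orbT.
split=> // q'; rewrite !inE => /or3P[qq|/eqP->//|qq];
  by apply: le_trans (ltW zw); apply: zmax; rewrite inE qq ?orbT.
Qed.

Lemma width_leP P u (t : R) : P != [::] ->
  width P u <= t <-> forall q q', q \in P -> q' \in P -> dotp u q <= dotp u q' + t.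
Proof.
move=> P0; have [q qP [qE qmax]] := suppP u P0.
have [z zP [zE zmax]] := suppP (- u) P0; rewrite /width; split=> [wt a b aP bP|all].
  by have := qmax _ aP; have := zmax _ bP; rewrite dotpNl; lra.
by have := all _ _ qP zP; rewrite qE zE dotpNl; lra.
Qed.

Lemma in_hull_neq_nil P v : in_hull P v -> P != [::].
Proof.
case: P => // -[a [_ /eqP]]; rewrite big_ord0 eq_sym oner_eq0 //.
Qed.

End Support.

(** * Void probabilities and the width distribution *)

Section Realization.
Variables (R : realType) (I : finType) (x : I -> 'rV[R]_2) (p : I -> R).

Lemma realized_eq_nil (B : {set I}) : (realized x B == [::]) = (B == set0).
Proof. by rewrite -size_eq0 size_image cards_eq0. Qed.

(** Expand over subsets the product of the sums (weight of presence) + (weight of absence), presence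
    having weight 0 on [D]. *)
Lemma void_prob (D : {set I}) :
  \sum_(B : {set I}) realization_pmf p B * [disjoint B & D]%:R
  = \prod_(i in D) (1 - p i).
Proof.
transitivity (\prod_i ((if i \in D then 0 else p i) + (1 - p i))); last first.
  rewrite [RHS]big_mkcond /=; apply: eq_bigr => i _.
  by case: ifP; rewrite ?add0r // addrC subrK.
rewrite bigA_distr /=; apply: eq_bigr => B _.
have -> : [disjoint B & D]%:R = \prod_i (if i \in B then (i \notin D)%:R else 1) :> R.
  case: (boolP [disjoint B & D]) => [dis|].
    by rewrite big1 // => i _; case: ifP => // iB; rewrite (disjointFr dis iB).
  rewrite disjoints_subset => /subsetPn[i iB]; rewrite inE negbK => iD.
  by rewrite (bigD1 i) //= iB iD mul0r.
rewrite /realization_pmf (big_mkcond (mem B)) (big_mkcond (mem (~: B))) -!big_split /=.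
apply: eq_bigr => i _; rewrite inE; case: (i \in B); case: (i \in D);
  by rewrite /= ?mulr1 ?mul1r ?mulr0.
Qed.

Lemma realization_pmf_ge0 : (forall i, 0 <= p i <= 1) -> forall B, 0 <= realization_pmf p B.
Proof.
move=> p01 B; apply: mulr_ge0; apply: prodr_ge0 => i _; have /andP[] := p01 i => //.
by rewrite subr_ge0.
Qed.

Lemma realization_pmf_sum1 : \sum_(B : {set I}) realization_pmf p B = 1.
Proof.
have := void_prob set0; rewrite big_set0 => <-.
by apply: eq_bigr => B _; rewrite disjoints_subset setC0 subsetT mulr1.
Qed.

(** The empty realization has an empty hull. This bound will keep the total rate away from 0. *)
Lemma hull_prob_le (v : 'rV[R]_2) : (forall i, 0 <= p i <= 1) ->
  hull_prob x p v <= 1 - \prod_i (1 - p i).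
Proof.
move=> p01; rewrite /hull_prob (prob_not _ realization_pmf_sum1) lerB //.
have := void_prob setT; under [RHS]eq_bigl do rewrite inE; move=> <-.
rewrite /prob [leRHS]big_mkcond /=; apply: ler_sum => B _.
have B0 := realization_pmf_ge0 p01 B.
case: asboolP => [_|/contrapT/in_hull_neq_nil]; first by rewrite ler_piMr // lern1 leq_b1.
rewrite realized_eq_nil => nB; rewrite (_ : [disjoint _ & _] = false) ?mulr0 //.
by apply: contraNF nB; rewrite disjoints_subset setCT subset0.
Qed.

Section Direction.
Variables (u : 'rV[R]_2) (t : R) (V : seq R).
Hypotheses (t_ge0 : 0 <= t) (V_uniq : uniq V).
Hypothesis V_full : forall i, dotp u (x i) \in V.
Notation val i := (dotp u (x i)).

Definition outside_co (c : R) : {set I} := [set i | (val i < c) || (c + t < val i)].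
Definition outside_oo (c : R) : {set I} := [set i | (val i <= c) || (c + t < val i)].

(* A realization of width at most [t] is empty, or has a unique minimal value
   [c], and then it avoids the first set below but not the second. *)
Lemma width_indicator (B : {set I}) :
  (width (realized x B) u <= t)%R%:R = (B == set0)%:R +
  \sum_(c <- V) ([disjoint B & outside_co c]%:R
               - [disjoint B & outside_oo c]%:R) :> R.
Proof.
have [->|B0] := eqVneq B set0.
  rewrite big1 => [|c _]; last by rewrite !disjoints_subset !sub0set subrr.
  have /eqP -> : realized x set0 == [::] by rewrite realized_eq_nil.
  by rewrite /width /supp !addr0 t_ge0.
rewrite add0r; have [i0 i0B] := set0Pn _ B0.
have [m mB mmin] := @Order.TotalTheory.arg_minP _ _ _ i0 (mem B) (fun i => val i) i0B.
have disjP (Q : pred I) : reflect (forall i, i \in B -> ~~ Q i) [disjoint B & [set i | Q i]].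
  rewrite disjoints_subset; apply: (iffP subsetP) => H i /H; by rewrite !inE.
(* Only the minimal value contributes: for any other [c], values that are all at least [c] are all
   greater than [c], so the two indicators agree. *)
rewrite (bigD1_seq (val m)) //= big1 ?addr0 => [|c cm]; last first.
  apply/eqP; rewrite subr_eq0; apply/eqP; congr (_%:R); congr nat_of_bool.
  apply/disjP/disjP => H i iB; have := H _ iB; rewrite !negb_or -!leNgt -!ltNge;
    move=> /andP[a b]; apply/andP; split=> //; last exact: ltW.
  rewrite lt_neqAle a andbT; apply: contra_neq cm => e.
  have := H _ mB; rewrite negb_or -leNgt => /andP[cm _]; apply/eqP.
  by rewrite eq_le cm e mmin.
have -> : [disjoint B & outside_oo (val m)] = false.
  by apply/negP => /disjP/(_ _ mB); rewrite lexx.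
rewrite subr0; congr (_%:R); congr nat_of_bool.
have nn : realized x B != [::] by rewrite realized_eq_nil.
apply/idP/disjP => [/(width_leP _ _ nn) w i iB|H].
  rewrite negb_or -!leNgt mmin //=; apply: w; exact: image_f.
apply/(width_leP _ _ nn) => _ _ /imageP[i iB ->] /imageP[j jB ->].
have := H i iB; rewrite negb_or -!leNgt => /andP[_ it]; apply: le_trans it _.
by rewrite lerD2r mmin.
Qed.

Variable r : I -> R.
Hypothesis r_exp : forall i, 1 - p i = expR (- r i).

Definition cumul (c : R) : R := \sum_(i | val i <= c) r i.
Definition cumul_lt (c : R) : R := \sum_(i | val i < c) r i.

(** Take the expectation of [width_indicator]. Each void region consists of two disjoint
    half-planes, so its probability is a product of two exponentials. *)
Lemma width_cdfE : width_cdf x p u t = expR (- \sum_i r i) +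
  \sum_(c <- V) (expR (- cumul_lt c) - expR (- cumul c))
    * expR (- (\sum_i r i - cumul (c + t))).
Proof.
have prodE (D : {set I}) : \prod_(i in D) (1 - p i) = expR (- \sum_(i in D) r i).
  by rewrite -sumrN expR_sum; apply: eq_bigr => i _; rewrite r_exp.
have tail c : \sum_i r i - cumul (c + t) = \sum_(i | c + t < val i) r i.
  rewrite (bigID (fun i => val i <= c + t)) /= -/(cumul _) addrAC subrr add0r.
  by apply: eq_bigl => i; rewrite -ltNge.
rewrite /width_cdf /prob.
transitivity (\sum_(B : {set I}) realization_pmf p B * (width (realized x B) u <= t)%R%:R).
  rewrite big_mkcond /=; apply: eq_bigr => B _; rewrite asboolb.
  by case: ifP; rewrite ?mulr1 ?mulr0.
under eq_bigr do rewrite width_indicator mulrDr mulr_sumr.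
rewrite big_split /= exchange_big /=; congr (_ + _).
  have := void_prob setT; rewrite prodE; under [in RHS]eq_bigl do rewrite inE.
  move=> <-; apply: eq_bigr => B _.
  by rewrite disjoints_subset setCT subset0.
apply: eq_bigr => c _; under eq_bigr do rewrite mulrBr.
rewrite sumrB !void_prob !prodE mulrBl -!expRD tail.
congr (expR _ - expR _); rewrite -opprD; congr (- _).
  rewrite /cumul_lt (bigID (fun i => val i < c)) /=; congr (_ + _); apply: eq_bigl => i;
    rewrite inE; first by case: (ltP (val i) c); rewrite ?andbF.
  case: (ltP (val i) c) => //= ic; rewrite ?andbT // ltNge.
  by rewrite (le_trans (ltW ic)) // lerDl.
rewrite /cumul (bigID (fun i => val i <= c)) /=; congr (_ + _); apply: eq_bigl => i;
  rewrite inE; first by case: (leP (val i) c); rewrite ?andbF.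
case: (leP (val i) c) => //= ic; rewrite ?andbT // ltNge.
by rewrite (le_trans ic) // lerDl.
Qed.

End Direction.

End Realization.

(** * Stability of the width distribution under changes of the rates *)

Lemma expRN_lipschitz (R : realType) (a b : R) : 0 <= a -> 0 <= b ->
  `|expR (- a) - expR (- b)| <= `|a - b|.
Proof.
wlog ab : a b / a <= b => [H a0 b0|a0 _].
  have [/H->//|/ltW/H] := leP a b.
  by rewrite distrC (distrC b); apply.
rewrite distrC ler0_norm ?subr_le0 ?ler_expR ?lerN2 // distrC ger0_norm ?subr_ge0 //.
have -> : expR (- b) = expR (- a) * expR (- (b - a)) by rewrite -expRD; congr expR; ring.
have e1 := expR_ge1Dx (- (b - a)); have e0 := expR_ge0 (- a).
have ea : expR (- a) <= 1 by rewrite -expR0 ler_expR oppr_le0.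
have ba : 0 <= b - a by rewrite subr_ge0.
by nra.
Qed.

(** Changing [b] costs [e], as the increments of [a] sum to at most 1. Changing [a] costs [2 * e]:
    Abel summation moves the differences onto the monotone [b'], and a boundary term remains. *)
Lemma stieltjes_stability (R : realType) (m : nat) (a a' b b' : nat -> R) (e : R) :
  0 <= e -> a 0 = a' 0 -> a 0 - a m <= 1 ->
  (forall k, (k < m)%N -> a k.+1 <= a k) ->
  (forall k, (k <= m)%N -> `|a k - a' k| <= e) ->
  (forall k, (k < m)%N -> `|b k - b' k| <= e) ->
  (forall k, (k < m)%N -> 0 <= b' k <= 1) ->
  (forall k, (k.+1 < m)%N -> b' k <= b' k.+1) ->
  `|\sum_(0 <= k < m) (a k - a k.+1) * b k
    - \sum_(0 <= k < m) (a' k - a' k.+1) * b' k| <= 3 * e.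
Proof.
move=> e0 aa0 am amono aa bb b01 bmono.
pose D k := a k - a' k.
have -> : \sum_(0 <= k < m) (a k - a k.+1) * b k
    - \sum_(0 <= k < m) (a' k - a' k.+1) * b' k
  = \sum_(0 <= k < m) (a k - a k.+1) * (b k - b' k)
    + \sum_(0 <= k < m) (D k - D k.+1) * b' k.
  by rewrite -sumrB -big_split /=; apply: eq_bigr => k _; rewrite /D; ring.
have part1 : `|\sum_(0 <= k < m) (a k - a k.+1) * (b k - b' k)| <= e.
  apply: le_trans (ler_norm_sum _ _ _) _.
  apply: (@le_trans _ _ (\sum_(0 <= k < m) (a k - a k.+1) * e)).
    apply: ler_sum_nat => k /andP[_ km]; rewrite normrM.
    by rewrite ger0_norm ?subr_ge0 ?amono // ler_wpM2l ?subr_ge0 ?amono // bb.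
  rewrite -mulr_suml.
  have -> : \sum_(0 <= k < m) (a k - a k.+1) = a 0 - a m.
    under eq_bigr do rewrite -opprB.
    by rewrite sumrN telescope_sumr // opprB.
  by rewrite ler_piMl.
(* With the boundary term added, the sum equals that of [D k * (b' k - b' (k - 1))] over
   [1 <= k <= n], because [D 0 = 0]. *)
have abel n : (n < m)%N ->
    `|\sum_(0 <= k < n.+1) (D k - D k.+1) * b' k + D n.+1 * b' n| <= e * (b' n - b' 0).
  elim: n => [_|n IH nm].
    rewrite big_nat1 subrr mulr0 -mulrDl subrK.
    by rewrite /D aa0 subrr mul0r normr0.
  rewrite big_nat_recr //=.
  have -> : forall S, S + (D n.+1 - D n.+2) * b' n.+1 + D n.+2 * b' n.+1
      = (S + D n.+1 * b' n) + D n.+1 * (b' n.+1 - b' n) by move=> S; ring.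
  apply: le_trans (ler_normD _ _) _.
  have := IH (ltnW nm); rewrite normrM (ger0_norm (_ : 0 <= b' n.+1 - b' n)); last first.
    by rewrite subr_ge0 bmono.
  have : `|D n.+1| * (b' n.+1 - b' n) <= e * (b' n.+1 - b' n).
    by rewrite ler_wpM2r ?subr_ge0 ?bmono // aa // ltnW.
  by move: (`|_ + _|) (`|_| * _) => *; nra.
have part2 : `|\sum_(0 <= k < m) (D k - D k.+1) * b' k| <= 2 * e.
  case: m {part1 am amono bb bmono} aa b01 abel => [|m] aa b01 abel.
    by rewrite big_geq // normr0 mulr_ge0.
  have := abel m (ltnSn m); move: (\sum_(0 <= k < _) _) => S Sle.
  have -> : S = (S + D m.+1 * b' m) - D m.+1 * b' m by ring.
  apply: le_trans (ler_normB _ _) _.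
  have /andP[m0 m1] := b01 m (ltnSn m); have /andP[z0 z1] := b01 0 (ltn0Sn m).
  have : `|D m.+1 * b' m| <= e.
    by apply: le_trans (aa m.+1 _) => //; rewrite normrM (ger0_norm m0) ler_piMr.
  by move: (`|_ + _|) Sle (`|_ * _|) => *; nra.
apply: le_trans (ler_normD _ _) _.
by move: part1 part2; lra.
Qed.

Section CumulSorted.
Variables (R : realType) (I : finType) (x : I -> 'rV[R]_2) (u : 'rV[R]_2).
Variables (r : I -> R) (V : seq R).
Hypotheses (V_sorted : sorted <%R V) (V_full : forall i, dotp u (x i) \in V).

Lemma cumul_lt_head : (0 < size V)%N -> cumul_lt x u r V`_0 = 0.
Proof.
move=> V0; rewrite /cumul_lt big_pred0 // => i; apply/negbTE; rewrite -leNgt.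
have iV : (index (dotp u (x i)) V < size V)%N by rewrite index_mem.
rewrite -(nth_index 0 (V_full i)).
by rewrite (lt_sorted_leq_nth 0 V_sorted).
Qed.

(** No projection lies strictly between consecutive entries of [V]; this turns the sum of
    [width_cdfE] into a Stieltjes sum. *)
Lemma cumul_lt_next k : (k.+1 < size V)%N ->
  cumul_lt x u r V`_k.+1 = cumul x u r V`_k.
Proof.
move=> kV; apply: eq_bigl => i.
have iV : (index (dotp u (x i)) V < size V)%N by rewrite index_mem.
rewrite -(nth_index 0 (V_full i)).
by rewrite (lt_sorted_ltn_nth 0 V_sorted) ?(lt_sorted_leq_nth 0 V_sorted) ?inE // ltnW.
Qed.

Hypothesis r_ge0 : forall i, 0 <= r i.

Lemma cumul_mono c d : c <= d -> cumul x u r c <= cumul x u r d.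
Proof.
move=> cd; rewrite /cumul !(big_mkcond (fun i => _ <= _)) /=; apply: ler_sum => i _.
case: ifP => [/le_trans-> //|_]; by case: ifP.
Qed.

Lemma cumul_ge0 c : 0 <= cumul x u r c.
Proof. exact: sumr_ge0. Qed.

Lemma cumul_le c : cumul x u r c <= \sum_i r i.
Proof.
rewrite /cumul big_mkcond /=; apply: ler_sum => i _.
by case: ifP.
Qed.

End CumulSorted.

Lemma width_cdf_stability (R : realType) (I J : finType)
    (x : I -> 'rV[R]_2) (x' : J -> 'rV[R]_2) (p r : I -> R) (p' r' : J -> R)
    (u : 'rV[R]_2) (t e : R) : 0 <= t ->
  (forall i, 1 - p i = expR (- r i)) -> (forall j, 1 - p' j = expR (- r' j)) ->
  (forall i, 0 <= r i) -> (forall j, 0 <= r' j) ->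
  \sum_i r i = \sum_j r' j ->
  (forall c, `|cumul x u r c - cumul x' u r' c| <= e) ->
  `|width_cdf x p u t - width_cdf x' p' u t| <= 3 * e.
Proof.
move=> t0 rE rE' r0 r0' tot close.
(* A grid common to both families lets the two sums be compared term by term; equal total rates
   cancel the empty-realization terms. *)
pose V : seq R := sort <=%R (undup ([seq dotp u (x i) | i : I] ++ [seq dotp u (x' j) | j : J])).
have V_sorted : sorted <%R V by rewrite sort_lt_sorted undup_uniq.
have V_uniq : uniq V by rewrite sort_uniq undup_uniq.
have V_full i : dotp u (x i) \in V.
  by rewrite mem_sort mem_undup mem_cat image_f.
have V_full' j : dotp u (x' j) \in V.
  by rewrite mem_sort mem_undup mem_cat image_f ?orbT.
have e0 : 0 <= e := le_trans (normr_ge0 _) (close 0).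
rewrite (width_cdfE t0 V_uniq V_full rE) (width_cdfE t0 V_uniq V_full' rE') -tot.
rewrite opprD addrACA subrr add0r !(@big_nth _ _ _ _ (0 : R) V).
(* The index is shifted by one: [a 0 = 1] stands for the empty half-plane before the first grid
   value. *)
pose a k := if k is k'.+1 then expR (- cumul x u r V`_k') else 1.
pose a' k := if k is k'.+1 then expR (- cumul x' u r' V`_k') else 1.
have lt_a k : (k < size V)%N -> expR (- cumul_lt x u r V`_k) = a k.
  by case: k => [|k] kV /=; rewrite ?cumul_lt_head ?oppr0 ?expR0 // cumul_lt_next.
have lt_a' k : (k < size V)%N -> expR (- cumul_lt x' u r' V`_k) = a' k.
  by case: k => [|k] kV /=; rewrite ?cumul_lt_head ?oppr0 ?expR0 // cumul_lt_next.
pose b k := expR (- (\sum_i r i - cumul x u r (V`_k + t))).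
pose b' k := expR (- (\sum_i r i - cumul x' u r' (V`_k + t))).
have -> : \sum_(0 <= k < size V) (expR (- cumul_lt x u r V`_k) - expR (- cumul x u r V`_k))
      * expR (- (\sum_i r i - cumul x u r (V`_k + t)))
    = \sum_(0 <= k < size V) (a k - a k.+1) * b k.
  by apply: eq_big_nat => k /andP[_ kV]; rewrite lt_a.
have -> : \sum_(0 <= k < size V) (expR (- cumul_lt x' u r' V`_k) - expR (- cumul x' u r' V`_k))
      * expR (- (\sum_i r i - cumul x' u r' (V`_k + t)))
    = \sum_(0 <= k < size V) (a' k - a' k.+1) * b' k.
  by apply: eq_big_nat => k /andP[_ kV]; rewrite lt_a'.
have V_mono k : (k.+1 < size V)%N -> V`_k <= V`_k.+1.
  by move=> kV; rewrite (lt_sorted_leq_nth 0 V_sorted) ?inE // ltnW.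
apply: stieltjes_stability => //.
- rewrite lerBlDr lerDl; case: (size V) => [|m] //=; exact: expR_ge0.
- move=> [|k] kV /=; first by rewrite -expR0 ler_expR oppr_le0 cumul_ge0.
  by rewrite ler_expR lerN2 cumul_mono // V_mono.
- move=> [|k] kV /=; first by rewrite subrr normr0.
  by apply: le_trans (expRN_lipschitz _ _) _; rewrite ?cumul_ge0.
- move=> k kV; apply: le_trans (expRN_lipschitz _ _) _.
  + by rewrite subr_ge0 cumul_le.
  + by rewrite subr_ge0 tot cumul_le.
  + rewrite opprB addrC addrA subrK distrC; exact: close.
- move=> k kV; rewrite expR_ge0 /= -expR0 ler_expR oppr_le0 subr_ge0 tot.
  exact: cumul_le.
- by move=> k kV; rewrite ler_expR lerN2 lerD2l lerN2 cumul_mono // lerD2r V_mono.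
Qed.

(** * Choice of the constants and transfer to the sampled point set *)

Theorem mainTheorem13 (R : realType) :
  exists c1 c2 C : R, [/\ 0 < c1, 0 < c2, 0 < C &
  forall (n : nat) (x : 'I_n -> 'rV[R]_2) (p : 'I_n -> R) (tau delta : R)
         (vstar : 'rV[R]_2),
    injective x ->
    (forall i, 0 < p i < 1) ->
    0 < tau <= 1 / 2 ->
    0 < delta < 1 ->
    1 - delta / 2 <= hull_prob x p vstar ->
    let lambda := total_rate p in
    let N := sample_size c1 c2 tau delta lambda in
    N%:R <= C * (lambda ^+ 2 / tau ^+ 2 * log_conf delta) /\
    1 - delta <= prob (iid_pmf (sampling_pmf p) (N := N)) (fun s =>
      forall (t : R) (u : 'rV[R]_2), 0 <= t -> u != 0 ->
        width_cdf x p u t - tau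
          <= width_cdf (fun j => x (s j)) (fun=> sample_exist_prob p N) u t
          <= width_cdf x p u t + tau)].
Proof.
pose c2 : R := 200 * 256 ^+ 2.
have c2_gt0 : 0 < c2 by rewrite mulr_gt0 // exprn_gt0.
(* [1 / 3] offsets the factor 3 of [width_cdf_stability], [c2] is the constant of
   [uniform_deviation], 9 is the inverse square of [1 / 3], and 2 pays for rounding up. *)
exists (1 / 3), c2, (9 * c2 + 2); split=> //; [lra|lra|].
move=> n x p tau delta vstar _ p01 /andP[tau0 tau2] /andP[d0 d1] hull lambda N.
have p1 i : 0 < 1 - p i by have /andP[_] := p01 i; rewrite subr_gt0.
have p01' i : 0 <= p i <= 1 by have /andP[/ltW-> /ltW->] := p01 i.
have rateE i : 1 - p i = expR (- rate p i) by rewrite /rate opprK lnK // posrE.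
have rate_ge0 i : 0 <= rate p i.
  rewrite /rate oppr_ge0 -ler_expR expR0 lnK ?posrE // gerBl.
  by have /andP[] := p01' i.
(* The hull hypothesis gives [expR (- lambda) <= delta / 2 < 1 / 2], and
   [1 - lambda <= expR (- lambda)]. *)
have lambda2 : 1 / 2 <= lambda.
  have : \prod_i (1 - p i) = expR (- lambda).
    by rewrite /lambda /total_rate -sumrN expR_sum; apply: eq_bigr => i _.
  have := hull_prob_le x vstar p01'; have := expR_ge1Dx (- lambda).
  by move: hull; lra.
have lambda0 : 0 < lambda by lra.
pose L := log_conf delta.
have max0 : 0 < Num.max 2 delta^-1 by rewrite lt_max ltr0n.
have expL : expR (- L) = (Num.max 2 delta^-1)^-1 by rewrite expRN lnK // posrE.
have L2 : expR (- L) <= 1 / 2.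
  by rewrite expL div1r lef_pV2 ?posrE // le_max lexx.
have Ld : expR (- L) <= delta.
  by rewrite expL invf_ple ?posrE // le_max lexx orbT.
have Lge : 1 / 2 <= L by have := expR_ge1Dx (- L); lra.
pose e := tau1 (1 / 3) tau lambda.
have eE : lambda * e = tau / 3 by rewrite /e /tau1; field; rewrite gt_eqF.
have e0 : 0 < e by rewrite /e /tau1 !mulr_gt0 ?invr_gt0.
have e1 : e <= 1.
  by have : tau / 3 <= lambda by [lra]; rewrite -eE; nra.
pose X := c2 * e ^- 2 * L.
have X0 : 0 < X by rewrite !mulr_gt0 ?invr_gt0 ?exprn_gt0 //; lra.
have NE : N%:R = (Num.ceil X)%:~R :> R.
  rewrite /N /sample_size -/e -/L -/X natr_absz ger0_norm //.
  by rewrite ceil_ge0; lra.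
have XN : X <= N%:R by rewrite NE ceil_ge.
have N0 : (0 < N)%N by rewrite -(ltr0n R); lra.
have NX : N%:R <= X + 1.
  by have := ceilB1_lt X; rewrite NE intrD; lra.
split.
  apply: le_trans NX _.
  rewrite -/L; set Y := lambda ^+ 2 / tau ^+ 2 * L.
  have -> : X = 9 * c2 * Y by rewrite /X /Y /e /tau1; field; rewrite !gt_eqF.
  have Y2 : 1 <= 2 * Y.
    have lt1 : 1 <= lambda / tau by rewrite ler_pdivlMr // mul1r; lra.
    have : 1 <= lambda ^+ 2 / tau ^+ 2 by rewrite -expr_div_n exprn_ege1.
    by rewrite /Y; move: (lambda ^+ 2 / tau ^+ 2) => q q1; nra.
  by rewrite [leRHS]mulrDl lerD2l.
have mu_ge0 i : 0 <= sampling_pmf p i by rewrite divr_ge0 // ltW.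
have mu_sum1 : \sum_i sampling_pmf p i = 1.
  by rewrite -mulr_suml divff // gt_eqF.
(* Lifting by a last coordinate [-1] turns the half-plane of points with [dotp u] at most [c] into
   the half-space of [(u, c)]. *)
pose y (i : 'I_n) : R * R * R := (x i 0 0, x i 0 1, -1).
have NL : 200 * 256 ^+ 2 * L <= N%:R * e ^+ 2.
  have -> : 200 * 256 ^+ 2 * L = X * e ^+ 2 by rewrite /X /c2; field; rewrite gt_eqF.
  by rewrite ler_wpM2r // sqr_ge0.
have e01 : 0 < e <= 1 by rewrite e0.
apply: le_trans (uniform_deviation y mu_ge0 mu_sum1 N0 e01 L2 Ld NL) _.
apply: prob_mono => [s|s good t u t0 u0]; first exact: iid_ge0.
(* The rate of each sample point, so the two total rates agree and a cumulative rate is [lambda]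
   times an empirical frequency. *)
pose r' (j : 'I_N) := lambda / N%:R.
have NR0 : (0 : R) < N%:R by rewrite ltr0n.
suff : `|width_cdf x p u t
    - width_cdf (fun j => x (s j)) (fun=> sample_exist_prob p N) u t| <= 3 * (tau / 3).
  by rewrite ler_norml => /andP[? ?]; apply/andP; split; lra.
apply: (@width_cdf_stability _ _ _ _ _ _ (rate p) _ r') => //.
- by move=> j; rewrite /sample_exist_prob opprB addrC subrK.
- by move=> j; rewrite divr_ge0 // ltW.
- by rewrite sumr_const card_ord -[RHS]mulr_natr divfK // gt_eqF.
move=> c; pose h : R * R * R := (u 0 0, u 0 1, c).
have h0 : h != 0.
  apply: contra_neq u0 => -[h1 h2 _]; apply/rowP => i; rewrite mxE.
  by case: i => -[|[|//]] lt; [rewrite -h1|rewrite -h2]; congr (u _ _); apply: val_inj.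
have hE : halfspace y h = [set i | dotp u (x i) <= c].
  apply/setP => i; rewrite !inE /dot3 /dotp /= mulrN1 subr_le0.
  by rewrite !big_ord_recl big_ord0 addr0 /=; congr (_ + u _ _ * x _ _ _ <= _); apply: val_inj.
have -> : cumul x u (rate p) c = lambda * mass (sampling_pmf p) (halfspace y h).
  rewrite hE /cumul /mass mulr_sumr; apply: eq_big => [i|i _]; first by rewrite inE.
  by rewrite /sampling_pmf mulrC divfK // gt_eqF.
have -> : cumul (fun j => x (s j)) u r' c = lambda * freq R s (halfspace y h).
  rewrite hE /cumul sumr_const -[LHS]mulr_natr /r' /freq [LHS]mulrAC [RHS]mulrA; congr (_ * _%:R / _).
  by apply: eq_card => j; rewrite !inE.
rewrite -mulrBr normrM gtr0_norm // -eE ler_wpM2l ?(ltW lambda0) // distrC.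
exact: good.
Qed.
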